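(* Let $K$ be a field, $S=K[x_1,\ldots,x_n]$, and let $(0)\neq I\subset S$ be a proper squarefree monomial ideal with $\operatorname{hdepth}(S/I)=4$. Then $\operatorname{hdepth}(I)\geq 4$.
   Context: $S=K[x_1,\ldots,x_n]$ is the polynomial ring over a field $K$ with its standard grading. For a nonzero finitely generated graded $S$-module $M$, the Hilbert depth $\operatorname{hdepth}(M)$ is the maximal depth of a finitely generated graded $S$-module $N$ having the same Hilbert series as $M$. *)

(* Defs.v *)
From HB Require Import structures.
From mathcomp Require Import all_boot all_order all_algebra.
From mathcomp Require Import mpoly.

Set Implicit Arguments.
Unset Strict Implicit.
Unset Printing Implicit Defensive.

Import GRing.Theory.

Local Open Scope ring_scope.
Local Open Scope quotient_scope.

(* The submodule generated by the finite family s, as a predicate. *)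
Definition in_span (R : nzRingType) (V : lmodType R) (s : seq V) (v : V) : Prop :=
  exists c : nat -> R, v = \sum_(i < size s) c i *: s`_i.

(* The submodule (f_1, ..., f_r) V, as a predicate. *)
Definition in_mulspan (R : nzRingType) (V : lmodType R) (fs : seq R) (v : V) : Prop :=
  exists w : nat -> V, v = \sum_(i < size fs) fs`_i *: w i.

Definition fin_generated (R : nzRingType) (V : lmodType R) : Prop :=
  exists s : seq V, forall v, in_span s v.

(* Z-graded modules over K[x_1, ..., x_n] with its standard grading. *)
Record gradedModule (K : fieldType) (n : nat) := GradedModule {
  gcarrier :> lmodType {mpoly K[n]};
  gcomp : int -> gcarrier -> Prop;
  gcomp0 : forall i, gcomp i 0;
  gcompD : forall i u v, gcomp i u -> gcomp i v -> gcomp i (u + v);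
  gcompZ : forall (d : nat) i p v,
    p \is d.-homog -> gcomp i v -> gcomp (d%:Z + i) (p *: v);
  gcomp_sum : forall v, exists (s : seq int) (f : int -> gcarrier),
    (forall i, gcomp i (f i)) /\ v = \sum_(i <- s) f i;
  gcomp_direct : forall (s : seq int) (f : int -> gcarrier),
    uniq s -> (forall i, gcomp i (f i)) -> \sum_(i <- s) f i = 0 ->
    forall i, i \in s -> f i = 0
}.

(* The K-subspace W of V has a K-basis with d elements; K acts through the
   constant polynomials. *)
Definition has_dim (K : fieldType) (n : nat) (V : lmodType {mpoly K[n]})
    (W : V -> Prop) (d : nat) : Prop :=
  exists b : 'I_d -> V, (forall j, W (b j)) /\
    forall v, W v ->
      exists! c : {ffun 'I_d -> K}, v = \sum_(j < d) (c j)%:MP_[n] *: b j.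

(* h i is the coefficient of t^i in the Hilbert series of M. *)
Definition has_hilbert_series (K : fieldType) (n : nat)
    (M : gradedModule K n) (h : int -> nat) : Prop :=
  forall i, has_dim (@gcomp K n M i) (h i).

Definition same_hilbert_series (K : fieldType) (n : nat)
    (M N : gradedModule K n) : Prop :=
  exists h : int -> nat, has_hilbert_series M h /\ has_hilbert_series N h.

Definition in_max_ideal (K : fieldType) (n : nat) (p : {mpoly K[n]}) : Prop :=
  @in_span {mpoly K[n]} {mpoly K[n]}^o [seq 'X_i | i : 'I_n] p.

(* f_1, ..., f_r in (x_1, ..., x_n) such that each f_(i+1) is a nonzerodivisor
   on V / (f_1, ..., f_i) V, and V <> (f_1, ..., f_r) V. *)
Definition regular_seq (K : fieldType) (n : nat) (V : lmodType {mpoly K[n]})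
    (fs : seq {mpoly K[n]}) : Prop :=
  [/\ forall f, f \in fs -> in_max_ideal f,
      forall (i : nat) (v : V), (i < size fs)%N ->
        in_mulspan (take i fs) (fs`_i *: v) -> in_mulspan (take i fs) v
    & exists v : V, ~ in_mulspan fs v].

Definition has_depth (K : fieldType) (n : nat) (V : lmodType {mpoly K[n]})
    (r : nat) : Prop :=
  (exists2 fs, regular_seq V fs & size fs = r) /\
  (forall fs, regular_seq V fs -> (size fs <= r)%N).

Definition has_hdepth (K : fieldType) (n : nat) (M : gradedModule K n)
    (r : nat) : Prop :=
  (exists N : gradedModule K n,
     [/\ fin_generated N, same_hilbert_series M N & has_depth N r]) /\
  (forall (N : gradedModule K n) (e : nat),
     fin_generated N -> same_hilbert_series M N -> has_depth N e -> (e <= r)%N).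

(* S/I is MathComp's {ideal_quot I}, here made an S-module. An idealr is
   proper by definition. *)
Section QuotientModule.
Variables (R : comNzRingType) (I : idealr R).

Definition quot_scale (a : R) (u : {ideal_quot I}) : {ideal_quot I} :=
  \pi_{ideal_quot I} a * u.

Fact quot_scaleA a b u : quot_scale a (quot_scale b u) = quot_scale (a * b) u.
Proof. by rewrite /quot_scale mulrA rmorphM. Qed.

Fact quot_scale1 : left_id 1 quot_scale.
Proof. by move=> u; rewrite /quot_scale rmorph1 mul1r. Qed.

Fact quot_scaleDr : right_distributive quot_scale +%R.
Proof. by move=> a u v; rewrite /quot_scale mulrDr. Qed.

Fact quot_scaleDl u : {morph quot_scale^~ u : a b / a + b}.
Proof. by move=> a b; rewrite /quot_scale rmorphD mulrDl. Qed.

HB.instance Definition _ := GRing.Zmodule_isLmodule.Build R {ideal_quot I}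
  quot_scaleA quot_scale1 quot_scaleDr quot_scaleDl.
End QuotientModule.

(* I itself as an S-module. *)
Section IdealModule.
Variables (R : comNzRingType) (I : idealr R).

Record ideal_mod := IdealMod { ideal_val :> R; _ : ideal_val \in I }.

HB.instance Definition _ := [isSub for ideal_val].
HB.instance Definition _ := [Choice of ideal_mod by <:].
HB.instance Definition _ := [SubChoice_isSubZmodule of ideal_mod by <:].

Definition ideal_scale (a : R) (u : ideal_mod) : ideal_mod :=
  IdealMod (idealMr a (valP u)).

Fact ideal_scaleA a b u :
  ideal_scale a (ideal_scale b u) = ideal_scale (a * b) u.
Proof. by apply: val_inj; rewrite /= mulrA. Qed.

Fact ideal_scale1 : left_id 1 ideal_scale.
Proof. by move=> u; apply: val_inj; rewrite /= mul1r. Qed.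

Fact ideal_scaleDr : right_distributive ideal_scale +%R.
Proof. by move=> a u v; apply: val_inj; rewrite /= mulrDr. Qed.

Fact ideal_scaleDl u : {morph ideal_scale^~ u : a b / a + b}.
Proof. by move=> a b; apply: val_inj; rewrite /= mulrDl. Qed.

HB.instance Definition _ := GRing.Zmodule_isLmodule.Build R ideal_mod
  ideal_scaleA ideal_scale1 ideal_scaleDr ideal_scaleDl.
End IdealModule.

Section Gradings.
Variables (K : fieldType) (n : nat).
Local Notation S := {mpoly K[n]}.

(* S_i, which is 0 for i < 0. *)
Definition std_comp (i : int) (p : S) : Prop :=
  if i is Posz d then p \is d.-homog else p = 0.

Definition homogeneous_ideal (I : idealr S) : Prop :=
  forall p d, p \in I -> pihomog mdeg d p \in I.

Definition squarefree_monomial_ideal (I : idealr S) : Prop :=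
  exists G : seq {set 'I_n}, forall p : S,
    p \in I <-> @in_span S S^o [seq \prod_(i in A) 'X_i | A : {set 'I_n} <- G] p.

Definition quot_comp (I : idealr S) (i : int) (u : {ideal_quot I}) : Prop :=
  exists2 p : S, std_comp i p & u = \pi_{ideal_quot I} p.

Definition ideal_comp (I : idealr S) (i : int) (u : ideal_mod I) : Prop :=
  std_comp i (val u).

Lemma std_comp0 i : std_comp i 0.
Proof. by case: i => // d; apply: dhomog0. Qed.

Lemma std_compD i p q : std_comp i p -> std_comp i q -> std_comp i (p + q).
Proof.
by case: i => [d|d] /= hp hq; [exact: dhomogD | rewrite hp hq addr0].
Qed.

Lemma std_compM (d : nat) i p q :
  p \is d.-homog -> std_comp i q -> std_comp (d%:Z + i) (p * q).
Proof.
case: i => [e|e] hp /= hq; first exact: dhomogM.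
by rewrite hq mulr0; apply: std_comp0.
Qed.

Definition std_pr (i : int) (p : S) : S :=
  if i is Posz d then pihomog mdeg d p else 0.

Lemma std_prP i p : std_comp i (std_pr i p).
Proof. by case: i => // d; apply: pihomogP. Qed.

Lemma std_pr_sum i (s : seq int) (f : int -> S) :
  uniq s -> (forall j, std_comp j (f j)) -> i \in s ->
  std_pr i (\sum_(j <- s) f j) = f i.
Proof.
move=> us hf si; case: i si => [d|d] si; last by have /= -> := hf (Negz d).
rewrite (bigD1_seq (Posz d)) //= raddfD /= pihomog_dE; last exact: (hf (Posz d)).
rewrite raddf_sum big1 ?addr0 // => -[e|e] /= ne.
  by apply: pihomog_ne0 (hf (Posz e)); apply: contraNneq ne => ->.
by have /= -> := hf (Negz e); rewrite raddf0.
Qed.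

Lemma std_pr_total p : exists s : seq int, p = \sum_(i <- s) std_pr i p.
Proof.
exists [seq Posz d | d <- iota 0 (msize p)]; rewrite big_map /=.
by rewrite -{1}(subn0 (msize p)) -/(index_iota _ _) big_mkord;
  apply: pihomog_partitionE.
Qed.

Lemma squarefree_monomial_homogeneous (I : idealr S) :
  squarefree_monomial_ideal I -> homogeneous_ideal I.
Proof.
case=> G hG p d pI; have /hG [c ->] := pI.
rewrite raddf_sum rpred_sum // => j _ /=.
set g := nth _ _ _.
have gI : (g : S) \in I.
  apply/hG; exists (fun k : nat => (k == val j)%:R).
  rewrite (bigD1 j) //= eqxx scale1r big1 ?addr0 // => k kj.
  by rewrite val_eqE (negPf kj) scale0r.
have [m gE] : exists m, (g : S) = 'X_[m].
  have jG : (j < size G)%N by rewrite -(size_map (fun A : {set 'I_n} => \prod_(i in A) 'X_i : S)).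
  rewrite /g (nth_map set0) //; elim/big_rec: _ => [|i q _ [m ->]].
    by exists 0%MM; rewrite mpolyX0.
  by exists (U_(i) + m)%MM; rewrite mpolyXD.
rewrite -[_ *: _]/(_ * _) [c j]mpolyE mulr_suml raddf_sum rpred_sum // => k _ /=.
rewrite -scalerAl linearZ /= gE -mpolyXD pihomogX -mul_mpolyC idealMr //.
by case: ifP; rewrite ?rpred0 // mpolyXD -gE => _; apply: idealMr.
Qed.

Section IdealGraded.
Variables (I : idealr S) (homI : homogeneous_ideal I).

Lemma std_pr_ideal i p : p \in I -> std_pr i p \in I.
Proof. by case: i => [d|d] pI /=; [exact: homI | exact: rpred0]. Qed.

Fact ideal_comp_sum (v : ideal_mod I) :
  exists (s : seq int) (f : int -> ideal_mod I),
    (forall i, ideal_comp i (f i)) /\ v = \sum_(i <- s) f i.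
Proof.
have [s vE] := std_pr_total (val v).
exists s, (fun i => IdealMod (std_pr_ideal i (valP v))).
split=> [i|]; first exact: std_prP.
by apply: val_inj; rewrite raddf_sum /= {1}vE.
Qed.

Fact ideal_comp_direct (s : seq int) (f : int -> ideal_mod I) :
  uniq s -> (forall i, ideal_comp i (f i)) -> \sum_(i <- s) f i = 0 ->
  forall i, i \in s -> f i = 0.
Proof.
move=> us hf /(congr1 val); rewrite raddf_sum /= => f0 i si.
apply: val_inj => /=; rewrite -(@std_pr_sum i s (fun i => val (f i))) // f0.
by case: i {si} => //= d; rewrite raddf0.
Qed.

Definition ideal_graded : gradedModule K n :=
  @GradedModule K n (ideal_mod I) (@ideal_comp I)
    (fun i => std_comp0 i)
    (fun i u v => @std_compD i (val u) (val v))
    (fun d i p v => @std_compM d i p (val v))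
    ideal_comp_sum ideal_comp_direct.

Fact quot_comp0 i : @quot_comp I i 0.
Proof. by exists 0; [exact: std_comp0 | rewrite raddf0]. Qed.

Fact quot_compD i (u v : {ideal_quot I}) :
  quot_comp i u -> quot_comp i v -> quot_comp i (u + v).
Proof.
move=> [p hp ->] [q hq ->].
by exists (p + q); [exact: std_compD | rewrite raddfD].
Qed.

Fact quot_compZ (d : nat) i p (v : {ideal_quot I}) :
  p \is d.-homog -> quot_comp i v -> quot_comp (d%:Z + i) (p *: v).
Proof.
move=> hp [q hq ->].
by exists (p * q); [exact: std_compM | rewrite rmorphM].
Qed.

Fact quot_comp_sum (v : {ideal_quot I}) :
  exists (s : seq int) (f : int -> {ideal_quot I}),
    (forall i, quot_comp i (f i)) /\ v = \sum_(i <- s) f i.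
Proof.
have [s vE] := std_pr_total (repr v).
exists s, (fun i => \pi_{ideal_quot I} (std_pr i (repr v))).
split=> [i|]; first by exists (std_pr i (repr v)) => //; exact: std_prP.
by rewrite -raddf_sum -vE; apply/esym/(@reprK _ {ideal_quot I}).
Qed.

Lemma quot_pi_eq0 p : (\pi_{ideal_quot I} p == 0) = (p \in I).
Proof. by rewrite -(raddf0 \pi_{ideal_quot I}) -Quotient.idealrBE subr0. Qed.

Fact quot_comp_direct (s : seq int) (f : int -> {ideal_quot I}) :
  uniq s -> (forall i, quot_comp i (f i)) -> \sum_(i <- s) f i = 0 ->
  forall i, i \in s -> f i = 0.
Proof.
move=> us hf f0.
have {hf}[g hg fE] : exists2 g : int -> S,
    forall i, i \in s -> std_comp i (g i) & forall i, i \in s -> f i = \pi_{ideal_quot I} (g i).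
  elim: s {us f0} => [|j s [g hg fE]]; first by exists (fun=> 0).
  have [p hp fp] := hf j.
  exists (fun i => if i == j then p else g i) => i; rewrite inE;
    by case: eqP => [->|] //= _; first [exact: hg | exact: fE].
pose g' i := if i \in s then g i else 0.
have hg' i : std_comp i (g' i).
  by rewrite /g'; case: ifP => [/hg|_] //; apply: std_comp0.
have g'I : \sum_(i <- s) g' i \in I.
  rewrite -quot_pi_eq0 raddf_sum; apply/eqP; rewrite -[RHS]f0.
  by apply: eq_big_seq => i si; rewrite /g' si fE.
move=> i si; rewrite fE //; apply/eqP; rewrite quot_pi_eq0.
have := std_pr_ideal i g'I; rewrite std_pr_sum //.
by rewrite /g' si.
Qed.

Definition quot_graded : gradedModule K n :=
  @GradedModule K n {ideal_quot I} (@quot_comp I) quot_comp0 quot_compD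
    quot_compZ quot_comp_sum quot_comp_direct.

End IdealGraded.
End Gradings.

(* Main.v *)
From HB Require Import structures.
Require Import Defs.
From Stdlib Require Import ClassicalEpsilon.
From mathcomp Require Import all_boot all_order all_algebra.
From mathcomp Require Import mpoly zify.

Set Implicit Arguments.
Unset Strict Implicit.
Unset Printing Implicit Defensive.

Import GRing.Theory.
Local Open Scope ring_scope.

(** Write U for the up-closed family of the A such that x_A lies in I, a_k for
    the number of its members of size k, and alpha_k = C(n, k) - a_k for the
    number of squarefree monomials of degree k outside I.  Note that a_0 = 0,
    since I is proper.

    Necessary condition.  If a graded module N with Hilbert function h has
    depth at least r, then (1 - t)^r times its Hilbert series has nonnegative
    coefficients ([regular_seq_nonneg_differences]).  The regular sequence need
    not be homogeneous, and K may be finite, so one cannot simply divide by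
    linear forms of S.  Instead, a regular sequence of length r in
    (x_1, ..., x_n) forces the Koszul cohomology H^i(x; N) to vanish for i < r
    ([regular_koszul_exact]).  This is a condition on finite matrices in each
    degree, so it survives the passage from K to K(t).  Over K(t) the form
    x_1 + t x_2 + ... + t^(n-1) x_n is a nonzerodivisor, by McCoy's argument on
    zero divisors of polynomials ([generic_form_row_free]).  Dividing by it
    replaces h by its first difference and r by r - 1, and induction concludes
    ([gmx_exact_nonneg_differences]).

    For S/I and r = 4 the coefficients of t, t^2 and t^3 give
      alpha_1 >= 4,   alpha_2 >= 3 alpha_1 - 6,
      alpha_3 >= 2 alpha_2 - 3 alpha_1 + 4.

    Combinatorics.  The coefficients of t, ..., t^4 in (1 - t)^4 H_I(t) are
      a_1,   a_2 - 3 a_1,   a_3 - 2 a_2 + 3 a_1,   a_4 - a_3 + a_2 - a_1,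
    and they are nonnegative ([level_inequalities]).  For n >= 8 this follows
    from (n - k) a_k <= (k + 1) a_(k+1), a double count.  For 4 <= n <= 7 it
    follows from the three inequalities above together with a Bonferroni bound:
    t sets of size k have at least t (n - k) - C(t, 2) upper covers, since two
    of them share at most one.

    Construction.  Each squarefree monomial of degree j in I contributes
    t^j / (1 - t)^j to H_I(t).  For j > 4 keep one summand
    K[x_1, ..., x_j](-j) for each of them; the others together contribute
    (b_1 t + b_2 t^2 + b_3 t^3 + b_4 t^4) / (1 - t)^4, where the b_k are the four
    coefficients above, and are replaced by b_k copies of K[x_1, ..., x_4](-k)
    for each k.  The resulting module has the Hilbert series of I,
    and x_1, ..., x_4 is a regular sequence on it
    ([sum_cutoff_shape], [leading_vars_regular]).

    Finally, if e is the lowest degree in which I is nonzero, the necessary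
    condition in degree e + 1 gives r h(e) <= h(e + 1), so the depths of the
    modules with this Hilbert series are bounded and a maximal one exists
    ([has_hdepth_ge]). *)

(** * The ordered Koszul complex *)

Section Coboundary.
Variables (I : Type) (A : Type) (B : zmodType).

(** The Koszul differential on cochains indexed by all words in the variables:
    the cochain is not required to be alternating.  A null-homotopy for
    multiplication by a combination of the variables is then just insertion of
    a letter in front of the word, and all proofs are structural inductions on
    words. *)
Fixpoint cobound (x : I -> A -> B) (c : seq I -> A) (s : seq I) : B :=
  if s is j :: s' then x j (c s') - cobound x (fun t => c (j :: t)) s' else 0.

Lemma eq_cobound x c c' s :
  (forall t, (size t).+1 = size s -> c t = c' t) -> cobound x c s = cobound x c' s.
Proof.
elim: s c c' => [|j s IH] c c' cc' //=.
rewrite cc' //; congr (_ - _); apply: IH => t st.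
by apply: cc'; rewrite /= st.
Qed.

End Coboundary.

Lemma cobound_zmod_morph (I A A' : Type) (B B' : zmodType) (x : I -> A -> B)
    (x' : I -> A' -> B') (f : A -> A') (g : B -> B') c s : zmod_morphism g ->
  (forall j a, g (x j a) = x' j (f a)) ->
  g (cobound x c s) = cobound x' (f \o c) s.
Proof.
move=> gB fg; elim: s c => [|j s IH] c /=; last by rewrite gB fg IH.
by rewrite -[LHS]/(g 0) -(subrr 0) gB subrr.
Qed.

Lemma cobound_morph (I A A' : Type) (B B' : zmodType) (x : I -> A -> B)
    (x' : I -> A' -> B') (f : A -> A') (g : {additive B -> B'}) c s :
  (forall j a, g (x j a) = x' j (f a)) ->
  g (cobound x c s) = cobound x' (f \o c) s.
Proof. exact/cobound_zmod_morph/raddfB. Qed.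

Lemma coboundB (I : Type) (A B : zmodType) (x : I -> {additive A -> B}) c c' s :
  cobound x (fun t => c t - c' t) s = cobound x c s - cobound x c' s.
Proof.
elim: s c c' => [|j s IH] c c' /=; first by rewrite subr0.
by rewrite raddfB IH !opprD addrACA.
Qed.

Lemma cobound_sum (I T : Type) (A B : zmodType) (x : I -> {additive A -> B})
    (r : seq T) (c : T -> seq I -> A) s :
  cobound x (fun t => \sum_(i <- r) c i t) s = \sum_(i <- r) cobound x (c i) s.
Proof.
elim: s c => [|j s IH] c /=; first by rewrite big1.
by rewrite raddf_sum IH sumrB.
Qed.

Lemma cobound_cobound (I : Type) (A : Type) (B C : zmodType) (x : I -> A -> B)
    (y : I -> {additive B -> C}) c s :
  (forall i j a, y i (x j a) = y j (x i a)) -> cobound y (cobound x c) s = 0.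
Proof.
move=> yx; elim: s c => [|j s IH] c //=.
rewrite [X in _ - X](_ : _ = y j (cobound x c s)) ?subrr //=.
rewrite coboundB IH subr0.
by rewrite (cobound_morph (x' := fun i => y i) (f := fun a => x j a)) // => i a; exact: yx.
Qed.

(** * Regular sequences make the Koszul complex exact *)

Section RegularExact.
Variables (R : comNzRingType) (V : lmodType R) (I : finType) (x : I -> R).
Implicit Types (U : V -> Prop) (c : seq I -> V).

Local Notation d := (cobound (fun j (v : V) => x j *: v)).

Definition submodule_pred U :=
  [/\ U 0, forall u v, U u -> U v -> U (u + v) & forall a v, U v -> U (a *: v)].

(** Vanishing of the Koszul cohomology of V/U in degrees below r. *)
Definition koszul_exact_mod U r :=
  forall i c, (i < r)%N -> (forall s, size s = i.+1 -> U (d c s)) ->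
  exists b, forall s, size s = i -> U (c s - d b s).

Lemma cobound_scale a c s : d (fun t => a *: c t) s = a *: d c s.
Proof.
rewrite (cobound_morph (x' := fun j v => x j *: v) (f := *:%R a) (g := *:%R a)) //.
by move=> j v /=; rewrite !scalerA mulrC.
Qed.

Lemma cobound_submod U c s : submodule_pred U ->
  (forall t, (size t).+1 = size s -> U (c t)) -> U (d c s).
Proof.
case=> U0 UD UZ; elim: s c => [|j s IH] c Uc //=.
apply: UD; first by apply/UZ/Uc.
by rewrite -scaleN1r; apply/UZ/IH => t st; apply: Uc; rewrite /= st.
Qed.

(** A linear combination of the variables acts as zero on Koszul cohomology. *)
Lemma koszul_homotopy (a : I -> R) c s :
  (\sum_j a j * x j) *: c s =
  d (fun t => \sum_j a j *: c (j :: t)) s + \sum_j a j *: d c (j :: s).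
Proof.
rewrite (cobound_sum (fun j => *:%R (x j))) -big_split scaler_suml /=.
apply: eq_bigr => j _.
rewrite (cobound_scale (a j) (fun t => c (j :: t))).
by rewrite scalerBr scalerA addrC subrK.
Qed.

(** The piece H^(i-1)(V/(U + fV)) -> H^i(V/U) -> H^i(V/U) of the long exact
    sequence of f: the second map is injective after the vanishing of the first
    group, and it is zero by the homotopy.  Working modulo a predicate avoids
    forming the quotient modules. *)
Lemma koszul_exact_step U (f : R) (a : I -> R) r :
  submodule_pred U -> f = \sum_j a j * x j ->
  (forall v, U (f *: v) -> U v) ->
  koszul_exact_mod (fun v => exists u w, U u /\ v = u + f *: w) r ->
  koszul_exact_mod U r.+1.
Proof.
move=> sU fE freg exr; have [U0 UD UZ] := sU.
have UN v : U v -> U (- v) by rewrite -scaleN1r; apply: UZ.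
have Usum (F : I -> V) : (forall j, U (F j)) -> U (\sum_j F j).
  by move=> UF; elim/big_ind: _.
move=> i c ir dcU.
pose y t := \sum_j a j *: c (j :: t).
have fc s : size s = i -> U (f *: c s - d y s).
  move=> si; rewrite fE koszul_homotopy addrC addKr.
  by apply: Usum => j; apply/UZ/dcU; rewrite /= si.
case: i ir dcU fc => [|i] ir dcU fc.
  exists (fun=> 0) => -[|//] _; rewrite subr0; apply: freg.
  by have := fc [::] (erefl _); rewrite subr0.
have [||z zP] := exr i y; first by [].
  move=> s si; exists (- (f *: c s - d y s)), (c s).
  by split; [exact/UN/fc | rewrite opprB subrK].
have [u_ u_P] : exists b, forall t, size t = i -> U (y t - d z t - f *: b t).
  have /choice [b bP] : forall t, exists w, size t = i -> U (y t - d z t - f *: w).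
    move=> t; case: (eqVneq (size t) i) => [ti|ni]; last by exists 0 => /eqP; rewrite (negPf ni).
    have [u [w [Uu wE]]] := zP t ti; exists w => _.
    by rewrite wE addrK.
  by exists b.
exists u_ => s si; apply: freg.
have -> : f *: (c s - d u_ s) = (f *: c s - d y s) + d (fun t => y t - d z t - f *: u_ t) s.
  have dd0 : d (d z) s = 0.
    apply: (cobound_cobound (y := fun j => *:%R (x j))) => j k v /=.
    by rewrite !scalerA mulrC.
  rewrite (coboundB (fun j => *:%R (x j))) (coboundB (fun j => *:%R (x j))).
  rewrite cobound_scale dd0 subr0.
  by rewrite scalerBr addrA subrK.
apply: UD; first exact: fc.
by apply: cobound_submod => // t; rewrite si => -[]; apply: u_P.
Qed.

Lemma in_mulspan_submod (fs : seq R) : submodule_pred (in_mulspan (V := V) fs).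
Proof.
split.
- by exists (fun=> 0); rewrite big1 // => i _; rewrite scaler0.
- move=> u v [w ->] [w' ->]; exists (fun i => w i + w' i).
  by rewrite -big_split; apply: eq_bigr => i _; rewrite scalerDr.
- move=> a v [w ->]; exists (fun i => a *: w i).
  by rewrite scaler_sumr; apply: eq_bigr => i _; rewrite !scalerA mulrC.
Qed.

Lemma in_mulspan_take (fs : seq R) p (v : V) : (p < size fs)%N ->
  in_mulspan (take p.+1 fs) v <->
  exists u w, in_mulspan (take p fs) u /\ v = u + fs`_p *: w.
Proof.
move=> ps; rewrite /in_mulspan (take_nth 0) // size_rcons.
split=> [[w ->]|[u [w [[w' ->] ->]]]].
  rewrite big_ord_recr /= nth_rcons ltnn eqxx.
  exists (\sum_(i < size (take p fs)) (take p fs)`_i *: w i), (w (size (take p fs))).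
  split; first by exists w.
  by congr (_ + _); apply: eq_bigr => i _; rewrite nth_rcons ltn_ord.
exists (fun i => if (i < size (take p fs))%N then w' i else w).
rewrite big_ord_recr /= nth_rcons ltnn eqxx; congr (_ + _).
by apply: eq_bigr => i _; rewrite nth_rcons ltn_ord.
Qed.

Lemma regular_koszul_exact (fs : seq R) :
  (forall f, f \in fs -> exists a : I -> R, f = \sum_j a j * x j) ->
  (forall i (v : V), (i < size fs)%N ->
     in_mulspan (take i fs) (fs`_i *: v) -> in_mulspan (take i fs) v) ->
  koszul_exact_mod (eq^~ 0) (size fs).
Proof.
move=> fsx fsreg.
have main p : (p <= size fs)%N -> koszul_exact_mod (in_mulspan (take (size fs - p) fs)) p.
  elim: p => [|p IH] pfs; first by [].
  set q := (size fs - p.+1)%N; have qE : (size fs - p = q.+1)%N by lia.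
  have qfs : (q < size fs)%N by lia.
  have [a fE] := fsx _ (mem_nth 0 qfs).
  apply: (koszul_exact_step (in_mulspan_submod _) fE); first by move=> v; apply: fsreg.
  move=> i c ip dcU; have [s ss|b bP] := IH (ltnW pfs) i c ip.
    by rewrite qE; apply/in_mulspan_take => //; apply: dcU.
  by exists b => s ss; apply/in_mulspan_take => //; rewrite -qE; exact: bP.
have z0 v : in_mulspan (take 0 fs) v <-> v = 0.
  by rewrite take0; split=> [[w ->]|->]; [rewrite big_ord0 | exists (fun=> 0); rewrite big_ord0].
move=> i c ip dc0; have [s ss|b bP] := main _ (leqnn _) i c ip.
  by rewrite subnn; apply/z0/dc0.
by exists b => s ss; apply/z0; move: (bP s ss); rewrite subnn.
Qed.

End RegularExact.

(** * Graded modules as families of matrices *)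

Section MatrixModule.
Variable n : nat.

(** A graded module with finite-dimensional components, in coordinates: row
    vectors of length [h k] in degree k, on which the j-th variable acts by
    right multiplication. *)
Definition gmx (R : pzRingType) (h : nat -> nat) :=
  'I_n -> forall k, 'M[R]_(h k, h k.+1).

Definition mxact (R : pzRingType) h (X : gmx R h) k j (u : 'rV[R]_(h k)) :
  'rV[R]_(h k.+1) := u *m X j k.

Definition gmx_comm (R : pzRingType) h (X : gmx R h) :=
  forall i j k, X i k *m X j k.+1 = X j k *m X i k.+1.

(** There is no condition on cochains with values in degree 0: the definition
    is used when [h 0 = 0]. *)
Definition gmx_exact (R : pzRingType) h (X : gmx R h) r :=
  forall k i (c : seq 'I_n -> 'rV[R]_(h k.+1)), (i < r)%N ->
  (forall s, size s = i.+1 -> cobound (mxact X (k := k.+1)) c s = 0) ->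
  exists b : seq 'I_n -> 'rV[R]_(h k),
    forall s, size s = i -> c s = cobound (mxact X (k := k)) b s.

Definition map_gmx (R R' : pzRingType) (f : R -> R') h (X : gmx R h) : gmx R' h :=
  fun j k => map_mx f (X j k).

Lemma gmx_exact_le (R : pzRingType) h (X : gmx R h) r r' :
  (r <= r')%N -> gmx_exact X r' -> gmx_exact X r.
Proof. by move=> rr' ex k i c ir; apply: ex; apply: leq_trans rr'. Qed.

(** Vanishing of H^0. *)
Lemma gmx_exact_socle (R : pzRingType) h (X : gmx R h) k (u : 'rV[R]_(h k.+1)) :
  gmx_exact X 1 -> (forall j, u *m X j k.+1 = 0) -> u = 0.
Proof.
move=> ex uX0; have [[|j [|//]] // _|b bP] := ex k 0%N (fun=> u) isT.
  by rewrite /= subr0; apply: uX0.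
exact: (bP [::]).
Qed.

Lemma map_cobound (R R' : pzRingType) (f : {rmorphism R -> R'}) h (X : gmx R h) k
    (c : seq 'I_n -> 'rV[R]_(h k)) s :
  map_mx f (cobound (mxact X (k := k)) c s) =
  cobound (mxact (map_gmx f X) (k := k)) (fun t => map_mx f (c t)) s.
Proof.
rewrite (cobound_morph (x' := mxact (map_gmx f X) (k := k)) (f := map_mx f)
  (g := map_mx f)) // => j a.
exact: map_mxM.
Qed.

Section Additive.
Variables (R : comNzRingType) (h : nat -> nat) (X : gmx R h).

Lemma cobound_mxB k c c' s : cobound (mxact X (k := k)) (fun t => c t - c' t) s
  = cobound (mxact X (k := k)) c s - cobound (mxact X (k := k)) c' s.
Proof. exact: (coboundB (fun j => mulmxr (X j k))). Qed.

Lemma cobound_mx_sum T (r : seq T) k c s :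
  cobound (mxact X (k := k)) (fun t => \sum_(i <- r) c i t) s
  = \sum_(i <- r) cobound (mxact X (k := k)) (c i) s.
Proof. exact: (cobound_sum (fun j => mulmxr (X j k))). Qed.

Lemma cobound_mxZ k a c s :
  cobound (mxact X (k := k)) (fun t => a *: c t) s
  = a *: cobound (mxact X (k := k)) c s.
Proof.
rewrite (cobound_morph (x' := mxact X (k := k)) (f := *:%R a) (g := *:%R a)) //.
by move=> j u /=; rewrite /mxact scalemxAl.
Qed.

Lemma cobound_cobound_mx k c s : gmx_comm X ->
  cobound (mxact X (k := k.+1)) (cobound (mxact X (k := k)) c) s = 0.
Proof.
move=> cX; apply: (cobound_cobound (y := fun j => mulmxr (X j k.+1))) => i j a /=.
by rewrite /mxact -!mulmxA cX.
Qed.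

Lemma cobound_mx_morph h' (Y : gmx R h') k k' (f : 'M[R]_(h k, h' k'))
    (g : 'M[R]_(h k.+1, h' k'.+1)) c s :
  (forall j, X j k *m g = f *m Y j k') ->
  cobound (mxact X (k := k)) c s *m g =
  cobound (mxact Y (k := k')) (fun t => c t *m f) s.
Proof.
move=> fg; have := @cobound_morph _ _ _ _ _ (mxact X (k := k)) (mxact Y (k := k'))
  (fun u => u *m f) (mulmxr g) c s; apply => j a /=.
by rewrite /mxact -!mulmxA fg.
Qed.

End Additive.

End MatrixModule.

(** * Extending scalars to a rational function field *)

Lemma frac_denom (R : idomainType) (x : {fraction R}) :
  exists2 d : R, d != 0 & exists a : R, tofrac d * x = tofrac a.
Proof.
elim/quotW: x => r; exists (\d_r); first exact: denom_ratioP.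
exists (\n_r); unlock FracField.tofrac; rewrite -[LHS]FracField.pi_mul.
apply/eqmodP/eqP; rewrite /= /FracField.mulf.
rewrite !numden_Ratio ?mulf_neq0 ?oner_neq0 ?denom_ratioP //.
by rewrite mulr1 !mul1r.
Qed.

Lemma frac_common_denom (R : idomainType) (T : finType) (v : T -> {fraction R}) :
  exists2 d : R, d != 0 & exists p : T -> R, forall t, tofrac d * v t = tofrac (p t).
Proof.
have [d dP] : exists d : T -> R, forall t, d t != 0 /\ exists a : R, tofrac (d t) * v t = tofrac a.
  apply: (@choice _ _ (fun t d => d != 0 /\ exists a : R, tofrac d * v t = tofrac a)) => t.
  by have [d d0 ad] := frac_denom (v t); exists d.
exists (\prod_t d t); first by apply/prodf_neq0 => t _; case: (dP t).
apply: (@choice _ _ (fun t a => tofrac _ * v t = tofrac a)) => t; have [_ [a aE]] := dP t.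
exists ((\prod_(t' | t' != t) d t') * a).
by rewrite (bigD1 t) //= [d t * _]mulrC !tofracM -mulrA aE.
Qed.

Section GenericForm.
Variables (n : nat) (K : fieldType) (h : nat -> nat) (X : gmx n K h).

Local Notation L := {fraction {poly K}}.
Local Notation tofrac := (@FracField.tofrac {poly K}).
Local Notation XP := (map_gmx (@polyC K) X).

Definition frac_gmx : gmx n L h := map_gmx tofrac XP.

(** One parameter is enough for a generic linear form, if the variables are
    given distinct powers of it. *)
Definition generic_form k : 'M[{poly K}]_(h k, h k.+1) :=
  \sum_(j < n) 'X^j *: XP j k.

Lemma coef_mul_map_polyC a b (p : 'rV[{poly K}]_a) (A : 'M[K]_(a, b)) q :
  map_mx (coefp q) (p *m map_mx polyC A) = map_mx (coefp q) p *m A.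
Proof.
apply/rowP=> l; rewrite !mxE /= coef_sum.
by apply: eq_bigr => i _; rewrite !mxE coefMC.
Qed.

Lemma coef_cobound k (c : seq 'I_n -> 'rV[{poly K}]_(h k)) q s :
  map_mx (coefp q) (cobound (mxact XP (k := k)) c s) =
  cobound (mxact X (k := k)) (fun t => map_mx (coefp q) (c t)) s.
Proof.
rewrite (cobound_morph (x' := mxact X (k := k)) (f := map_mx (coefp q))
  (g := map_mx (coefp q))) // => j a.
exact: coef_mul_map_polyC.
Qed.

Lemma map_polyC_rV a (p : 'rV[{poly K}]_a) N :
  (forall l, (size (p 0%R l) <= N)%N) ->
  p = \sum_(q < N) 'X^q *: map_mx polyC (map_mx (coefp q) p).
Proof.
move=> pN; apply/rowP=> l; rewrite summxE; apply/polyP=> i.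
rewrite coef_sum; under eq_bigr => q _ do rewrite !mxE coefMC coefXn.
case: (ltnP i N) => [iN|Ni].
  rewrite (bigD1 (Ordinal iN)) //= eqxx mul1r big1 ?addr0 // => q qi.
  by rewrite -val_eqE /= eq_sym in qi; rewrite (negPf qi) mul0r.
rewrite nth_default; last exact: leq_trans (pN l) Ni.
rewrite big1 // => q _; case: eqP => [iq|]; last by rewrite mul0r.
by have := ltn_ord q; rewrite -iq ltnNge Ni.
Qed.

Lemma map_tofrac_inj a b : injective (fun A : 'M[{poly K}]_(a, b) => map_mx tofrac A).
Proof.
move=> A B /matrixP AB; apply/matrixP=> i j; apply/eqP.
by have /eqP := AB i j; rewrite !mxE tofrac_eq.
Qed.

Lemma frac_gmx_comm : gmx_comm X -> gmx_comm frac_gmx.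
Proof. by move=> cX i j k; rewrite /frac_gmx /map_gmx -!map_mxM cX. Qed.

(** After clearing denominators a cocycle over K(t) is a polynomial in t whose
    coefficients are cocycles over K, and these can be lifted separately. *)
Lemma frac_gmx_exact r : gmx_exact X r -> gmx_exact frac_gmx r.
Proof.
move=> exX k i c ir dc0.
pose T : finType := (i.-tuple 'I_n * 'I_(h k.+1))%type.
have [d d0 [p pE]] := frac_common_denom (fun t : T => c t.1 0 t.2).
pose P (s : seq 'I_n) : 'rV[{poly K}]_(h k.+1) :=
  if insub s is Some t then \row_l p (t : i.-tuple 'I_n, l) else 0.
have PE s : size s = i -> tofrac d *: c s = map_mx tofrac (P s).
  move=> si; apply/rowP=> l; rewrite /P insubT ?si //= => si'.
  by rewrite !mxE -pE.
have dP0 s : size s = i.+1 -> cobound (mxact XP (k := k.+1)) P s = 0.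
  move=> si; apply: map_tofrac_inj; rewrite map_mx0 map_cobound.
  have /eq_cobound -> : forall t, (size t).+1 = size s ->
      map_mx tofrac (P t) = tofrac d *: c t.
    by move=> t; rewrite si => -[] /PE.
  by rewrite cobound_mxZ dc0 ?scaler0.
have /choice [b bP] : forall q, exists b : seq 'I_n -> 'rV[K]_(h k),
    forall s, size s = i ->
      map_mx (coefp q) (P s) = cobound (mxact X (k := k)) b s.
  move=> q; apply: exX ir _ => s si.
  by rewrite -coef_cobound dP0 // map_mx0.
pose N := \max_t size (p t).
have PN s l : (size (P s 0%R l) <= N)%N.
  rewrite /P; case: insubP => [t _ _|_]; rewrite mxE ?size_poly0 //.
  exact: leq_bigmax.
exists (fun s => (tofrac d)^-1 *:
  map_mx tofrac (\sum_(q < N) 'X^q *: map_mx polyC (b q s))) => s si.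
rewrite cobound_mxZ -map_cobound cobound_mx_sum.
have -> : \sum_(q < N) cobound (mxact XP (k := k))
    (fun t => 'X^q *: map_mx polyC (b q t)) s = P s.
  rewrite [RHS](map_polyC_rV (PN s)); apply: eq_bigr => q _.
  by rewrite cobound_mxZ -map_cobound bP.
by rewrite -PE // scalerA mulVf ?scale1r // tofrac_eq0.
Qed.

Lemma mul_generic_form k (p : 'rV[{poly K}]_(h k)) :
  p *m generic_form k = \sum_(j < n) 'X^j *: (p *m XP j k).
Proof. by rewrite mulmx_sumr; apply: eq_bigr => j _; rewrite scalemxAr. Qed.

Lemma generic_form_comm j k : gmx_comm X ->
  generic_form k *m XP j k.+1 = XP j k *m generic_form k.+1.
Proof.
move=> cX; rewrite mulmx_suml mulmx_sumr; apply: eq_bigr => i _.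
by rewrite -scalemxAl -scalemxAr /map_gmx -!map_mxM cX.
Qed.

Lemma size_mul_map_polyC a b (p : 'rV[{poly K}]_a) (A : 'M[K]_(a, b)) N l :
  (forall l, (size (p 0%R l) <= N)%N) -> (size ((p *m map_mx polyC A) 0%R l) <= N)%N.
Proof.
move=> pN; apply/leq_sizeP => q Nq.
have /rowP/(_ l) := coef_mul_map_polyC p A q; rewrite mxE /= => ->.
rewrite mxE big1 // => i _; rewrite mxE /=.
by have /leq_sizeP -> := pN i; rewrite ?mul0r.
Qed.

(** McCoy's argument.  If p is killed by the form and has degree at most N in t,
    then by descending induction on j every x_j p vanishes: once x_i p = 0 for
    i > j, the coefficient of t^(j+N) shows that x_j p has degree less than N
    in t, and x_j p is again killed by the form.  So all coefficients of p are
    killed by all the variables. *)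
Lemma generic_form_regular_poly N k (p : 'rV[{poly K}]_(h k.+1)) :
  gmx_comm X -> gmx_exact X 1 -> (forall l, (size (p 0%R l) <= N)%N) ->
  p *m generic_form k.+1 = 0 -> p = 0.
Proof.
move=> cX exX; elim: N k p => [|N IH] k p pN pg0.
  by apply/rowP=> l; have := pN l; rewrite leqn0 size_poly_eq0 mxE => /eqP.
suff pX0 j : p *m XP j k.+1 = 0.
  apply/rowP => l; apply/polyP => q; rewrite [in RHS]mxE coef0.
  have: map_mx (coefp q) p = 0.
    apply: (gmx_exact_socle exX) => j.
    by rewrite -coef_mul_map_polyC -/(XP j _) pX0 map_mx0.
  by move=> /rowP/(_ l); rewrite !mxE.
have [m mj] := ubnP (n - j)%N; elim: m => // m IHm in j mj *.
have {}IHm (i : 'I_n) : (j < i)%N -> p *m XP i k.+1 = 0.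
  by move=> ji; apply: IHm; have := ltn_ord i; lia.
apply: IH; last first.
  by rewrite -mulmxA -generic_form_comm // mulmxA pg0 mul0mx.
move=> l; apply/leq_sizeP => q; rewrite leq_eqVlt => /predU1P[<-{q}|Nq]; last first.
  by have /leq_sizeP -> := size_mul_map_polyC (X j k.+1) l pN.
have /rowP/(_ l)/polyP/(_ (j + N)%N) := pg0.
rewrite mul_generic_form summxE [in RHS]mxE coef0 coef_sum (bigD1 j) //=.
rewrite mxE coefXnM ltnNge leq_addr addKn /= big1 ?addr0 // => i ij.
rewrite mxE coefXnM; case: ltnP => // ijN.
have [ji|ji|ji] := ltngtP i j; last by rewrite (val_inj ji) eqxx in ij.
  by move/leq_sizeP: (size_mul_map_polyC (X i k.+1) l pN); apply; lia.
by rewrite IHm // mxE coef0.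
Qed.

Lemma generic_form_row_free k : gmx_comm X -> gmx_exact X 1 ->
  row_free (map_mx tofrac (generic_form k.+1)).
Proof.
move=> cX exX; rewrite -kermx_eq0; apply/eqP/row_matrixP => i; rewrite row0.
set u := row i _.
have uG : u *m map_mx tofrac (generic_form k.+1) = 0.
  by rewrite -row_mul mulmx_ker row0.
have [d d0 [p pE]] := frac_common_denom (fun l => u 0 l).
have pu : map_mx tofrac (\row_l p l) = tofrac d *: u.
  by apply/rowP=> l; rewrite !mxE -pE !mxE.
have p0 : \row_l p l = 0 :> 'rV_(h k.+1).
  apply: (@generic_form_regular_poly (\max_l size (p l))) => // [l|].
    by rewrite mxE; apply: leq_bigmax.
  apply: map_tofrac_inj; rewrite map_mxM pu -scalemxAl uG scaler0.
  by rewrite map_mx0.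
move: pu; rewrite p0 map_mx0 => /esym/eqP; rewrite scalemx_eq0 tofrac_eq0.
by rewrite (negPf d0) /= => /eqP.
Qed.

End GenericForm.

(** * Cutting by a regular form *)

Section Quotient.
Variables (n : nat) (F : fieldType) (h : nat -> nat) (X : gmx n F h).
Variable G : forall k, 'M[F]_(h k, h k.+1).
Hypothesis cX : gmx_comm X.
Hypothesis GX : forall j k, G k *m X j k.+1 = X j k *m G k.+1.
Hypothesis G_free : forall k, row_free (G k).
Hypothesis h0 : h 0%N = 0%N.

(** The quotient by the image of G, in a basis of the column space of the
    cokernel. *)
Definition quo_dim k := if k is k'.+1 then \rank (cokermx (G k')) else 0%N.

Definition quo_proj k : 'M[F]_(h k, quo_dim k) :=
  if k is k'.+1 then col_base (cokermx (G k')) else 0.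

Definition quo_lift k : 'M[F]_(quo_dim k, h k) := pinvmx (quo_proj k).

Lemma quo_dimS k : quo_dim k.+1 = (h k.+1 - h k)%N.
Proof. by rewrite /= mxrank_coker (eqP (G_free k)). Qed.

Lemma quo_dim_le k : (h k <= h k.+1)%N.
Proof. by rewrite -(eqP (G_free k)) rank_leq_col. Qed.

Lemma quo_liftK k : quo_lift k *m quo_proj k = 1%:M.
Proof.
apply: mulVpmx; case: k => [|k]; first by rewrite /row_full mxrank0.
exact: col_base_full.
Qed.

Lemma quo_proj_ker m k (A : 'M[F]_(m, h k.+1)) :
  A *m quo_proj k.+1 = 0 -> exists W, A = W *m G k.
Proof.
move=> AQ; apply/submxP; rewrite submxE -(mulmx_base (cokermx (G k))) mulmxA.
by rewrite [X in X *m _]AQ mul0mx.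
Qed.

Lemma quo_projG k : G k *m quo_proj k.+1 = 0.
Proof.
apply: (row_free_inj (row_base_free (cokermx (G k)))).
by rewrite -mulmxA mulmx_base mulmx_coker mul0mx.
Qed.

Definition quo_gmx : gmx n F quo_dim :=
  fun j k => quo_lift k *m X j k *m quo_proj k.+1.

Lemma quo_gmx_proj j k : X j k *m quo_proj k.+1 = quo_proj k *m quo_gmx j k.
Proof.
case: k => [|k].
  by apply/matrixP => i; have := ltn_ord i; rewrite {2}h0.
have [|W WE] := @quo_proj_ker _ k (1%:M - quo_proj k.+1 *m quo_lift k.+1).
  by rewrite mulmxBl mul1mx -mulmxA quo_liftK mulmx1 subrr.
rewrite /quo_gmx (mulmxA (quo_proj _)) (mulmxA (quo_proj _)).
apply/eqP; rewrite -subr_eq0 -{1}(mul1mx (X j k.+1)) -!mulmxBl WE.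
by rewrite -(mulmxA W) GX (mulmxA W) -(mulmxA (W *m _)) quo_projG mulmx0.
Qed.

Lemma quo_gmx_comm : gmx_comm quo_gmx.
Proof.
move=> i j k; rewrite {1}/quo_gmx {2}/quo_gmx.
rewrite -[LHS]mulmxA -[RHS]mulmxA -!quo_gmx_proj -!mulmxA.
by congr (_ *m _); rewrite (mulmxA (X i k)) (mulmxA (X j k)) cX.
Qed.

(** The long exact sequence of G, chased on cochains: H^i of the quotient lies
    between H^i(X) and H^(i+1)(X). *)
Lemma quo_gmx_exact r : gmx_exact X r.+1 -> gmx_exact quo_gmx r.
Proof.
move=> exX k i c ir dc0.
have projd k' e s := cobound_mx_morph e s (quo_gmx_proj ^~ k').
have formd k' e s : cobound (mxact X (k := k')) e s *m G k'.+1 =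
    cobound (mxact X (k := k'.+1)) (fun t => e t *m G k') s.
  by apply: cobound_mx_morph => j; rewrite GX.
pose cl s := c s *m quo_lift k.+1.
have clK s : cl s *m quo_proj k.+1 = c s by rewrite -mulmxA quo_liftK mulmx1.
(* e is the image of c under the connecting map to H^(i+1). *)
have /choice [e eP] : forall s, exists w, size s = i.+1 ->
    cobound (mxact X (k := k.+1)) cl s = w *m G k.+1.
  move=> s; have [si|ni] := eqVneq (size s) i.+1; last by exists 0 => /eqP; rewrite (negPf ni).
  have [|w wE] := @quo_proj_ker 1 k.+1 (cobound (mxact X (k := k.+1)) cl s).
    by rewrite projd -[RHS](dc0 s si); apply: eq_cobound => t _; rewrite clK.
  by exists w.
have [|a aP] := exX k i.+1 e ir.
  move=> s si; apply: (row_free_inj (G_free k.+2)).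
  rewrite mul0mx formd -[RHS](cobound_cobound_mx cl s cX).
  by apply: eq_cobound => t; rewrite si => -[] /eP ->.
have [|b bP] := exX k i (fun s => cl s - a s *m G k) (ltnW ir).
  move=> s si; rewrite cobound_mxB -formd eP // aP //.
  exact: subrr.
exists (fun s => b s *m quo_proj k) => s si.
have := bP s si => /(congr1 (mulmx^~ (quo_proj k.+1))).
by rewrite mulmxBl clK -mulmxA quo_projG mulmx0 subr0 projd.
Qed.

End Quotient.

(** * Positivity of iterated differences *)

(** For [h 0 = 0] this says that (1 - t)^q times the generating series of h has
    nonnegative coefficients for all q <= r.  Truncated subtraction is harmless
    since each level asserts monotonicity before subtracting, and [k.-1] gives
    the value 0 in degree 0. *)
Fixpoint nonneg_differences r (h : nat -> nat) : Prop :=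
  if r is r'.+1 then
    (forall k, (h k <= h k.+1)%N) /\ nonneg_differences r' (fun k => h k - h k.-1)%N
  else True.

Lemma eq_nonneg_differences r h h' :
  h =1 h' -> nonneg_differences r h -> nonneg_differences r h'.
Proof.
elim: r h h' => [|r IH] h h' //= hh' [hle hr]; split=> [k|]; first by rewrite -!hh'.
by apply: IH hr => k; rewrite !hh'.
Qed.

(** Each step passes to a new ground field, the function field of the previous
    one, which is why K is generalized in the induction. *)
Theorem gmx_exact_nonneg_differences n (K : fieldType) h (X : gmx n K h) r :
  h 0%N = 0%N -> gmx_comm X -> gmx_exact X r -> nonneg_differences r h.
Proof.
elim: r K h X => // r IH K h X h0 cX exX /=.
pose G k := map_mx (@FracField.tofrac {poly K}) (generic_form X k).
have G_free k : row_free (G k).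
  case: k => [|k]; last by apply: generic_form_row_free => //; apply: gmx_exact_le exX.
  have := rank_leq_row (G 0%N); rewrite /row_free; move: (\rank _) => m.
  by rewrite h0 leqn0.
have GX j k : G k *m frac_gmx X j k.+1 = frac_gmx X j k *m G k.+1.
  by rewrite /frac_gmx /map_gmx -!map_mxM generic_form_comm.
have cXF := frac_gmx_comm cX.
split=> [k|]; first exact: (quo_dim_le G_free).
have := IH _ _ (quo_gmx (frac_gmx X) G) (erefl _) (quo_gmx_comm cXF GX h0).
move/(_ (quo_gmx_exact cXF GX G_free h0 (frac_gmx_exact exX))).
apply: eq_nonneg_differences => -[|k]; first by rewrite /= subnn.
by rewrite (quo_dimS G_free).
Qed.

(** * The homogeneous components of a graded module *)

Section GradedModule.
Variables (K : fieldType) (n : nat) (N : gradedModule K n).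
Local Notation S := {mpoly K[n]}.

Lemma gcompN i (v : N) : gcomp i v -> gcomp i (- v).
Proof.
move=> vi; rewrite -scaleN1r -(add0r i); apply: (gcompZ (d := 0)) => //.
by rewrite rpredN dhomog1.
Qed.

Lemma gcompB i (u v : N) : gcomp i u -> gcomp i v -> gcomp i (u - v).
Proof. by move=> ui vi; apply/gcompD/gcompN. Qed.

Lemma gcomp_bigsum i T (r : seq T) (F : T -> N) :
  (forall t, gcomp i (F t)) -> gcomp i (\sum_(t <- r) F t).
Proof.
by move=> Fi; elim/big_ind: _ => //; [exact: gcomp0 | move=> u v; exact: gcompD].
Qed.

Lemma gcompC i (a : K) (v : N) : gcomp i v -> gcomp i (a%:MP *: v).
Proof.
move=> vi; rewrite -(add0r i); apply: (gcompZ (d := 0)) => //.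
by rewrite -alg_mpolyC dhomogZ // dhomog1.
Qed.

Lemma gcompX j i (v : N) : gcomp i v -> gcomp (i + 1) ('X_j *: v).
Proof.
move=> vi; rewrite addrC; apply: (gcompZ (d := 1)) => //.
by rewrite dhomogX; apply/eqP/mdeg1. Qed.

(** The homogeneous components of v, as a function on all degrees, so that it
    is determined by v. *)
Definition decomposition (v : N) (f : int -> N) :=
  (forall i, gcomp i (f i)) /\
  exists s : seq int, [/\ uniq s, forall i, i \notin s -> f i = 0
    & v = \sum_(i <- s) f i].

Lemma decomposition_exists v : exists f, decomposition v f.
Proof.
have [s [f [fi ->]]] := gcomp_sum v.
exists (fun i => f i *+ count_mem i s); split=> [i|].
  elim: (count_mem i s) => [|m IH]; first exact: gcomp0.
  by rewrite mulrS; apply: gcompD.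
exists (undup s); split; first exact: undup_uniq.
  by move=> i; rewrite mem_undup => /count_memPn ->.
by rewrite -[LHS]big_undup_iterop_count.
Qed.

Lemma big_support_sub (e : int -> N) (r t : seq int) :
  uniq r -> uniq t -> {subset r <= t} -> (forall i, i \notin r -> e i = 0) ->
  \sum_(i <- r) e i = \sum_(i <- t) e i.
Proof.
move=> ur ut rt er; rewrite [RHS](bigID (mem r)) /= [X in _ + X]big1 ?addr0; last first.
  by move=> k /er.
rewrite -[RHS]big_filter; apply: perm_big; apply: uniq_perm => //.
  exact: filter_uniq.
by move=> k; rewrite mem_filter; case: (boolP (k \in r)) => // /rt ->.
Qed.

Lemma decomposition_unique v f g :
  decomposition v f -> decomposition v g -> f =1 g.
Proof.
case=> fi [s [us fs vf]] [gi [s' [us' gs' vg]]] i.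
pose t := undup (s ++ s').
have st : {subset s <= t} by move=> k ks; rewrite mem_undup mem_cat ks.
have st' : {subset s' <= t} by move=> k ks; rewrite mem_undup mem_cat ks orbT.
have [it|] := boolP (i \in t); last first.
  by rewrite mem_undup mem_cat negb_or => /andP[/fs -> /gs' ->].
apply/eqP; rewrite -subr_eq0; apply/eqP.
apply: (@gcomp_direct _ _ N t (fun k => f k - g k)) => //; first exact: undup_uniq.
  by move=> k; apply: gcompB.
rewrite sumrB -(big_support_sub us _ st fs) ?undup_uniq //.
by rewrite -(big_support_sub us' _ st' gs') ?undup_uniq // -vf -vg subrr.
Qed.

Lemma decompositionB u v f g : decomposition u f -> decomposition v g ->
  decomposition (u - v) (fun i => f i - g i).
Proof.
case=> fi [s [us fs ->]] [gi [s' [us' gs' ->]]]; split=> [i|]; first exact: gcompB.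
pose t := undup (s ++ s').
exists t; split; first exact: undup_uniq.
  by move=> i; rewrite mem_undup mem_cat negb_or => /andP[/fs -> /gs' ->]; rewrite subr0.
by rewrite sumrB; congr (_ - _); apply: big_support_sub;
  rewrite ?undup_uniq // => k ks; rewrite mem_undup mem_cat ks ?orbT.
Qed.

Lemma decompositionX j v f : decomposition v f ->
  decomposition ('X_j *: v) (fun i => 'X_j *: f (i - 1)).
Proof.
case=> fi [s [us fs ->]]; split=> [i|].
  by rewrite -{1}(subrK 1 i); apply: gcompX.
exists (map (+%R^~ 1) s); split; first by rewrite map_inj_uniq //; apply: addIr.
  move=> i ni; rewrite fs ?scaler0 //; apply: contra ni => is_.
  by apply/mapP; exists (i - 1); rewrite ?subrK.
by rewrite big_map scaler_sumr; apply: eq_bigr => i _; rewrite addrK.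
Qed.

Lemma decomposition_comp i v : gcomp i v ->
  decomposition v (fun k => if k == i then v else 0).
Proof.
move=> vi; split=> [k|]; first by case: eqP => [->|_] //; apply: gcomp0.
exists [:: i]; split=> // [k|]; first by rewrite inE => /negPf ->.
by rewrite big_seq1 eqxx.
Qed.

Lemma component_exists : exists pr : int -> N -> N,
  [/\ forall i v, gcomp i (pr i v), forall i v, gcomp i v -> pr i v = v,
      forall i, zmod_morphism (pr i)
    & forall i j v, pr (i + 1) ('X_j *: v) = 'X_j *: pr i v].
Proof.
have [f fP] := choice decomposition decomposition_exists.
exists (fun i v => f v i); split=> [i v|i v vi|i u v|i j v].
- by case: (fP v).
- by rewrite (decomposition_unique (fP v) (decomposition_comp vi)) eqxx.
- exact: (decomposition_unique (fP _) (decompositionB (fP u) (fP v))).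
- by rewrite (decomposition_unique (fP _) (decompositionX j (fP v))) addrK.
Qed.

End GradedModule.

Section MatrixForm.
Variables (K : fieldType) (n : nat) (N : gradedModule K n).
Variables (h : nat -> nat) (deg : nat -> int).
Hypothesis degS : forall k, deg k.+1 = deg k + 1.
Hypothesis dimN : forall k, has_dim (@gcomp K n N (deg k)) (h k).

Lemma matrix_form : exists (emb : forall k, 'rV[K]_(h k) -> N) (X : gmx n K h),
  [/\ forall k, zmod_morphism (emb k),
      forall k u, gcomp (deg k) (emb k u),
      forall k v, gcomp (deg k) v -> exists u, v = emb k u,
      forall k, injective (emb k)
    & forall j k u, emb k.+1 (u *m X j k) = 'X_j *: emb k u].
Proof.
pose bas k := proj1_sig (constructive_indefinite_description _ (dimN k)).
have basP k : (forall j, gcomp (deg k) (bas k j)) /\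
    forall v, gcomp (deg k) v ->
      exists! c : {ffun 'I_(h k) -> K}, v = \sum_(j < h k) (c j)%:MP_[n] *: bas k j.
  by rewrite /bas; case: (constructive_indefinite_description _ _).
pose emb k (u : 'rV[K]_(h k)) : N := \sum_j (u 0 j)%:MP_[n] *: bas k j.
have embi k u : gcomp (deg k) (emb k u).
  by apply: gcomp_bigsum => j; apply: gcompC; case: (basP k).
have embP k v : gcomp (deg k) v -> exists u, v = emb k u.
  case: (basP k) => _ basv /basv [c [vE _]]; exists (\row_j c j).
  by rewrite /emb {1}vE; apply: eq_bigr => j _; rewrite mxE.
have embI k : injective (emb k).
  move=> u u' uu'; have [c [_ cU]] := (basP k).2 _ (embi k u).
  have cE (w : 'rV_(h k)) : emb k u = emb k w -> c =1 w 0.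
    move=> uw i; rewrite (cU (finfun (w 0))) ?ffunE // uw.
    by apply: eq_bigr => j _; rewrite ffunE.
  by apply/rowP=> j; rewrite -(cE u) // -(cE u').
have [X XP] : exists X : gmx n K h, forall j k i,
    emb k.+1 (row i (X j k)) = 'X_j *: bas k i.
  have H (t : 'I_n * nat) : exists A : 'M[K]_(h t.2, h t.2.+1), forall i,
      emb t.2.+1 (row i A) = 'X_t.1 *: bas t.2 i.
    case: t => j k /=.
    have /choice [r rP] : forall i, exists u, emb k.+1 u = 'X_j *: bas k i.
      move=> i; have [|u ->] := embP k.+1 ('X_j *: bas k i); last by exists u.
      by rewrite degS; apply: gcompX; case: (basP k).
    by exists (\matrix_i r i) => i; rewrite rowK.
  pose X j k := proj1_sig (constructive_indefinite_description _ (H (j, k))).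
  exists X => j k i; rewrite /X.
  by case: (constructive_indefinite_description _ _) => /= A ->.
have embB k : zmod_morphism (emb k).
  move=> u v; rewrite /emb -sumrB; apply: eq_bigr => j _.
  by rewrite !mxE mpolyCB scalerBl.
exists emb, X; split=> // j k u.
rewrite mulmx_sum_row /emb scaler_sumr; under eq_bigr => l _.
  rewrite summxE rmorph_sum scaler_suml /=.
  under eq_bigr => i _ do rewrite mxE mpolyCM -scalerA.
  over.
rewrite exchange_big; apply: eq_bigr => i _ /=.
by rewrite -scaler_sumr -/(emb k.+1 _) XP !scalerA mulrC.
Qed.

(** A lift of a homogeneous cochain can be made homogeneous by projecting it to
    the degree below, so exactness over S gives exactness of the matrices. *)
Lemma koszul_exact_nonneg_differences r :
  h 0%N = 0%N ->
  koszul_exact_mod (fun j : 'I_n => 'X_j) (fun v : N => v = 0) r ->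
  nonneg_differences r h.
Proof.
move=> h0 exN.
have [emb [X [embB embi embP embI embX]]] := matrix_form.
have [pr [pri prK prB prX]] := component_exists N.
have emb0 k : emb k 0 = 0 by have := embB k 0 0; rewrite !subrr.
have emb_cobound k c s : emb k.+1 (cobound (mxact X (k := k)) c s) =
    cobound (fun j (v : N) => 'X_j *: v) (fun t => emb k (c t)) s.
  by apply: (cobound_zmod_morph (f := emb k)) => // j u; apply: embX.
apply: (gmx_exact_nonneg_differences (X := X)) => // [i j k|k i c ir dc0].
  apply/row_matrixP => l; rewrite !row_mul; apply: embI.
  by rewrite !embX !(rowE l) !embX !scalerA mulrC.
have [|b bP] := exN i (fun s => emb k.+1 (c s)) ir.
  by move=> s si; rewrite -emb_cobound dc0.
have /choice [b' b'P] : forall s, exists u, pr (deg k) (b s) = emb k u.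
  by move=> s; apply: embP.
exists b' => s si; apply: embI; rewrite emb_cobound.
rewrite -(prK _ _ (embi k.+1 (c s))) (subr0_eq (bP s si)) degS.
rewrite (cobound_zmod_morph (x' := fun j (v : N) => 'X_j *: v) (f := pr (deg k))) //.
by apply: eq_cobound => t _; rewrite /= b'P.
Qed.

End MatrixForm.

(** Everything below degree e can be cut off because h vanishes at e. *)
Theorem regular_seq_nonneg_differences (K : fieldType) n (N : gradedModule K n)
    (h : int -> nat) (fs : seq {mpoly K[n]}) (e : int) :
  has_hilbert_series N h -> regular_seq N fs -> h e = 0%N ->
  nonneg_differences (size fs) (fun k => h (e + k%:Z)).
Proof.
move=> hN [fsm fsreg _] he.
apply: (@koszul_exact_nonneg_differences _ _ N _ (fun k => e + k%:Z)).
- by move=> k; rewrite -addrA -[k.+1]addn1 PoszD.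
- by move=> k; apply: hN.
- by rewrite addr0.
apply: regular_koszul_exact fsreg => f /fsm [c ->].
exists (fun j : 'I_n => c j).
rewrite -(big_mkord xpredT (fun i => c i *: nth _ _ i)) size_map size_enum_ord big_mkord.
apply: eq_bigr => j _; rewrite (nth_map j) ?size_enum_ord ?ltn_ord //.
by rewrite nth_ord_enum.
Qed.

(** * Upward closed families of finite sets *)

Section UpwardClosed.
Variables (T : finType).
Implicit Types (A B : {set T}) (F U : {set {set T}}).

Definition level U k := [set A in U | #|A| == k].

Definition upper_covers A := [set x |: A | x in ~: A].

Lemma card_upper_covers A : #|upper_covers A| = (#|T| - #|A|)%N.
Proof.
rewrite card_in_imset; first by rewrite -(cardsC A) addKn.
move=> x y; rewrite !inE => xA yA /setP/(_ x); rewrite !inE eqxx (negPf xA).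
by rewrite orbF; case: eqP.
Qed.

Lemma upper_coversP A B : B \in upper_covers A ->
  A \subset B /\ #|B| = #|A|.+1.
Proof.
case/imsetP=> x; rewrite inE => xA ->.
by rewrite subsetUr cardsU1 xA.
Qed.

Section Levels.
Variable U : {set {set T}}.
Hypothesis upU : forall A B, A \in U -> A \subset B -> B \in U.

Lemma upper_covers_level A k B :
  A \in level U k -> B \in upper_covers A -> B \in level U k.+1.
Proof.
rewrite inE => /andP[AU /eqP Ak] /upper_coversP[AB Bk].
by rewrite inE (upU AU AB) Bk Ak eqxx.
Qed.

(** Double counting of the pairs A < B in U with #|A| = k and #|B| = k + 1: A has
    n - k upper covers, all of them in U, and B covers at most k + 1 sets. *)
Lemma level_growth k : ((#|T| - k) * #|level U k| <= k.+1 * #|level U k.+1|)%N.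
Proof.
have -> : ((#|T| - k) * #|level U k| =
    \sum_(A in level U k) \sum_(B in level U k.+1 | B \in upper_covers A) 1)%N.
  rewrite mulnC -sum_nat_const; apply: eq_bigr => A AU.
  have Ak : #|A| = k by move: AU; rewrite inE => /andP[_ /eqP].
  rewrite sum1dep_card -[in LHS]Ak -card_upper_covers; apply: eq_card => B; rewrite !inE.
  case: (boolP (B \in upper_covers A)); rewrite ?andbF // => BA.
  by have := upper_covers_level AU BA; rewrite !inE => ->.
rewrite (exchange_big_dep (mem (level U k.+1))) //=; last by move=> A B _ /andP[].
rewrite mulnC -sum_nat_const; apply: leq_sum => B; rewrite inE => /andP[_ /eqP Bk].
rewrite -Bk -(leq_add2l 0) add0n.
apply: (@leq_trans #|[set B :\ x | x in B]|); last exact: leq_imset_card.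
rewrite sum1dep_card; apply/subset_leq_card/subsetP => A; rewrite inE => /and3P[_ _].
case/imsetP=> x; rewrite inE => xA ->; apply/imsetP; exists x; first by rewrite setU11.
by rewrite setU1K.
Qed.

(** Bonferroni: two distinct sets of the same size have at most one common upper
    cover, their union, so each new member of F adds at least n - k covers minus
    the number of its predecessors. *)
Lemma card_bigcup_upper_covers F k : (forall A, A \in F -> #|A| = k) ->
  (2 * (#|F| * (#|T| - k)) <= 2 * #|\bigcup_(A in F) upper_covers A| + #|F| * #|F|.-1)%N.
Proof.
have [m] := ubnP #|F|; elim: m F => // m IH F Fm Fk.
have [->|[A AF]] := set_0Vmem F; first by rewrite cards0 !mul0n muln0.
have F'k B : B \in F :\ A -> #|B| = k by rewrite inE => /andP[_ /Fk].
have cF : #|F| = #|F :\ A|.+1 by rewrite (cardsD1 A F) AF.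
have {IH} := IH (F :\ A) _ F'k; rewrite -ltnS -cF => /(_ Fm).
set V := \bigcup_(B in F :\ A) upper_covers B => IHF.
have -> : \bigcup_(B in F) upper_covers B = V :|: upper_covers A.
  by rewrite -{1}(setD1K AF) bigcup_setU big_set1 setUC.
have := cardsUI V (upper_covers A); rewrite card_upper_covers (Fk A AF).
have : (#|V :&: upper_covers A| <= #|F :\ A|)%N.
  apply: leq_trans (leq_imset_card (fun B => A :|: B) (F :\ A)).
  apply/subset_leq_card/subsetP => C; rewrite inE => /andP[/bigcupP[B BF BC] AC].
  apply/imsetP; exists B => //; apply/esym/eqP.
  have [sBC cBC] := upper_coversP BC; have [sAC cAC] := upper_coversP AC.
  rewrite eqEcard subUset sAC sBC /= cAC (Fk A AF) ltnNge.
  apply/negP => cAB; move: BF; rewrite inE => /andP[/negP]; rewrite inE => BA BF; apply: BA.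
  rewrite eqEcard (Fk A AF) (Fk B BF) leqnn andbT.
  suff -> : A = A :|: B by apply: subsetUr.
  by apply/eqP; rewrite eqEcard subsetUl (Fk A AF).
move: IHF; rewrite cF; move: #|V| #|_ :&: _| #|_ :|: _| #|F :\ A| (#|T| - k)%N.
by move=> v w u f c; case: f => [|f] /=; nia.
Qed.

Lemma level_growth_few k t : (t <= #|level U k|)%N ->
  (2 * (t * (#|T| - k)) <= 2 * #|level U k.+1| + t * t.-1)%N.
Proof.
move=> tU; pose F := [set A in take t (enum (level U k))].
have FU A : A \in F -> A \in level U k by rewrite inE => /mem_take; rewrite mem_enum.
have cF : #|F| = t.
  rewrite cardsE; have /card_uniqP -> := take_uniq t (enum_uniq (level U k)).
  by rewrite size_takel // -cardE.
have := @card_bigcup_upper_covers F k; rewrite cF => /(_ _)/leq_trans; apply.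
  by move=> A /FU; rewrite inE => /andP[_ /eqP].
rewrite leq_add2r leq_pmul2l //; apply/subset_leq_card/bigcupsP => A /FU AU.
by apply/subsetP => B; apply: upper_covers_level.
Qed.

End Levels.
End UpwardClosed.

(** The hypotheses on C(n, k) - a k are the positivity of (1 - t)^4 H(t) for the
    complement of the family in degrees 1 to 3.  The growth bound alone settles
    n >= 8, where its ratios (n - 1)/2, (n - 2)/3 and (n - 3)/4 are large
    enough; the remaining n are a finite check. *)
Lemma level_inequalities n (a : nat -> nat) :
  (forall k, (n - k) * a k <= k.+1 * a k.+1)%N ->
  (forall k t, t <= a k -> 2 * (t * (n - k)) <= 2 * a k.+1 + t * t.-1)%N ->
  (a 1 + 4 <= 'C(n, 1))%N ->
  (3 * ('C(n, 1) - a 1) <= 'C(n, 2) - a 2 + 6)%N ->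
  (2 * ('C(n, 2) - a 2) + 4 <= 'C(n, 3) - a 3 + 3 * ('C(n, 1) - a 1))%N ->
  (a 2 <= 'C(n, 2))%N -> (a 3 <= 'C(n, 3))%N ->
  [/\ 3 * a 1 <= a 2, 2 * a 2 <= a 3 + 3 * a 1 & a 3 + a 1 <= a 4 + a 2]%N.
Proof.
move=> growth few d1 d2 d3 c2 c3.
have [n8|n8] := leqP 8 n.
  have g1 : (7 * a 1 <= 2 * a 2)%N by apply: leq_trans (growth 1%N); rewrite leq_mul2r; lia.
  have g2 : (6 * a 2 <= 3 * a 3)%N by apply: leq_trans (growth 2%N); rewrite leq_mul2r; lia.
  have g3 : (5 * a 3 <= 4 * a 4)%N by apply: leq_trans (growth 3%N); rewrite leq_mul2r; lia.
  by split; lia.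
have := growth 1%N; have := growth 2%N; have := growth 3%N.
have := few 1%N 1%N; have := few 1%N 2%N.
have := few 2%N 1%N; have := few 2%N 2%N; have := few 2%N 3%N.
have := few 2%N 4%N; have := few 2%N 6%N; have := few 3%N 4%N.
move: {growth few} d1 d2 d3 c2 c3; rewrite bin1.
move: (a 1%N) (a 2%N) (a 3%N) (a 4%N) => a1 a2 a3 a4.
(* n < 4 contradicts a 1 + 4 <= n; then each n keeps only the bounds it needs. *)
case: n n8 => [|[|[|[|n]]]]; do ?[by move=> _ *; lia].
case: n => [|[|[|[|n]]]] //= _ d1 d2 d3 c2 c3 f34 f26 f24 f23 f22 f21 f12 f11 g3 g2 g1.
- by move: d2 d3 c2 c3; rewrite (_ : 'C(4, 2) = 6%N) // (_ : 'C(4, 3) = 4%N) //;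
  clear -d1 g1; split; lia.
- by move: d2 d3 c2 c3; rewrite (_ : 'C(5, 2) = 10%N) // (_ : 'C(5, 3) = 10%N) //;
  clear -d1 f11 f21 f24 g2 g3; split; lia.
- by move: d2 d3 c2 c3; rewrite (_ : 'C(6, 2) = 15%N) // (_ : 'C(6, 3) = 20%N) //;
  clear -d1 f11 f12 f22 f26 f34 g2 g3; split; lia.
- by move: d2 d3 c2 c3; rewrite (_ : 'C(7, 2) = 21%N) // (_ : 'C(7, 3) = 35%N) //;
  clear -d1 f23 g1 g2 g3; split; lia.
Qed.

(** * Counting monomials *)

Section Monomials.
Variable n : nat.
Implicit Types (m : 'X_{1..n}) (A : {set 'I_n}).

Definition monomials d : seq 'X_{1..n} :=
  map val [seq m : 'X_{1..n < d.+1} <- enum predT | mdeg m == d].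

Lemma mem_monomials d m : (m \in monomials d) = (mdeg m == d).
Proof.
apply/mapP/idP => [[m' + ->]|md]; first by rewrite mem_filter => /andP[].
have mlt : (mdeg m < d.+1)%N by rewrite (eqP md).
by exists (BMultinom mlt) => //; rewrite mem_filter /= md mem_enum.
Qed.

Lemma monomials_uniq d : uniq (monomials d).
Proof. by rewrite map_inj_uniq; [rewrite filter_uniq ?enum_uniq | exact: val_inj]. Qed.

Definition mnm_support m : {set 'I_n} := [set i | m i != 0%N].

Lemma mnm_supportD m m' : mnm_support (m + m') = mnm_support m :|: mnm_support m'.
Proof. by apply/setP=> i; rewrite !inE mnmDE addn_eq0 negb_and. Qed.

Lemma mnm_support_mesym1 A : mnm_support (mesym1 A) = A.
Proof. by apply/setP=> i; rewrite inE mnmE; case: (i \in A). Qed.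

Lemma mesym1_le m A : (mesym1 A <= m)%MM = (A \subset mnm_support m).
Proof.
apply/mnm_lepP/subsetP => [le i iA|sub i].
  by have := le i; rewrite mnmE iA inE lt0n.
by rewrite mnmE; have := sub i; rewrite inE -lt0n; case: (i \in A) => // ->.
Qed.

(** Stars and bars; no variables leave only the monomial 1. *)
Definition count_monomials j d : nat := if j is j'.+1 then 'C((d + j')%N, d) else (d == 0%N).

Lemma count_monomialsS j d :
  count_monomials j.+1 d.+1 = (count_monomials j d.+1 + count_monomials j.+1 d)%N.
Proof. by case: j => [|j] /=; [rewrite !addn0 !binn | rewrite addnS addSnnS binS]. Qed.

(** Pascal's rule: a monomial of positive degree either avoids a given variable
    or is divisible by it. *)
Lemma count_monomials_support A d :
  count (fun m => mnm_support m \subset A) (monomials d) = count_monomials #|A| d.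
Proof.
have [k] := ubnP (#|A| + d)%N; elim: k => // k IH in A d *.
rewrite ltnS; case: d => [|d] Adk.
  have -> : count_monomials #|A| 0 = 1%N by case: #|A| => //= j; rewrite bin0.
  rewrite -size_filter -[RHS]/(size [:: 0%MM : 'X_{1..n}]).
  apply/perm_size/uniq_perm; rewrite ?filter_uniq ?monomials_uniq //.
  move=> m; rewrite mem_filter mem_monomials mdeg_eq0 inE andb_idl // => /eqP ->.
  by apply/subsetP => i; rewrite inE mnm0E.
have [A0|[a aA]] := set_0Vmem A.
  rewrite A0 cards0 /=; apply/eqP; rewrite -leqn0 leqNgt -has_count; apply/hasPn => m.
  rewrite mem_monomials; apply: contraTN; rewrite subset0 => /eqP/setP m0.
  suff -> : m = 0%MM by rewrite mdeg0.
  by apply/mnmP=> i; have := m0 i; rewrite !inE mnm0E => /negbFE/eqP.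
have cA : #|A| = #|A :\ a|.+1 by rewrite (cardsD1 a) aA.
rewrite cA count_monomialsS -{1}IH -?cA -?IH; try lia.
rewrite -!size_filter -[X in (_ = _ + X)%N](size_map (fun m => m + U_(a))%MM) -size_cat.
apply/perm_size/uniq_perm; rewrite ?filter_uniq ?monomials_uniq //.
  rewrite cat_uniq ?filter_uniq ?monomials_uniq //= map_inj_uniq; last exact: addIm.
  rewrite filter_uniq ?monomials_uniq // andbT; apply/hasPn => _ /mapP[m _ ->].
  rewrite /= mem_filter; apply/negP => /andP[/subsetP/(_ a)].
  by rewrite !inE mnmDE mnm1E eqxx addn1 => /(_ isT).
move=> m; rewrite mem_cat !mem_filter !mem_monomials; apply/idP/idP.
  case/andP=> mA md; have [ma|ma] := eqVneq (m a) 0%N.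
    apply/orP; left; rewrite md andbT; apply/subsetP=> i im; rewrite !inE (subsetP mA) // andbT.
    by apply: contraTneq im => ->; rewrite inE ma.
  apply/orP; right; apply/mapP; exists (m - U_(a))%MM; last first.
    by rewrite submK // lep1mP.
  rewrite mem_filter mem_monomials; apply/andP; split.
    apply/subsetP=> i; rewrite inE mnmBE => im; apply: (subsetP mA); rewrite inE.
    by apply: contraNneq im => mi0; rewrite mi0 sub0n.
  have : (mdeg (m - U_(a) + U_(a)) == d.+1)%N by rewrite submK ?lep1mP.
  by rewrite mdegD mdeg1 addn1.
case/orP=> [/andP[mA ->]|/mapP[m' + ->]].
  by rewrite andbT; apply: subset_trans mA (subD1set _ _).
rewrite mem_filter mem_monomials => /andP[mA /eqP <-].
rewrite mdegD mdeg1 addn1 eqxx andbT mnm_supportD subUset mA /=.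
by apply/subsetP=> i; rewrite inE mnm1E; have [<-|] := eqVneq a i.
Qed.

(** The Hilbert function of K[x_1, ..., x_j](-k). *)
Definition shifted_count j k d : nat := if (k <= d)%N then count_monomials j (d - k)%N else 0%N.

(** Dividing by the product of the variables in A. *)
Lemma count_monomials_exact_support A d :
  count (fun m => mnm_support m == A) (monomials d) = shifted_count #|A| #|A| d.
Proof.
rewrite /shifted_count; case: leqP => [Ad|dA].
  rewrite -count_monomials_support -!size_filter.
  rewrite -[RHS](size_map (fun m => m + mesym1 A)%MM).
  apply/perm_size/uniq_perm; rewrite ?filter_uniq ?monomials_uniq //.
    rewrite map_inj_uniq; last exact: addIm.
    by rewrite filter_uniq ?monomials_uniq.
  move=> m; rewrite mem_filter mem_monomials; apply/andP/mapP => [[/eqP mA /eqP md]|].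
    have Am : (mesym1 A <= m)%MM by rewrite mesym1_le mA.
    exists (m - mesym1 A)%MM; last by rewrite submK.
    rewrite mem_filter mem_monomials; apply/andP; split.
      apply/subsetP=> i; rewrite inE mnmBE -mA inE; apply: contraNneq => ->.
      by rewrite sub0n.
    by rewrite -md -{2}(submK Am) mdegD mdeg_mesym1 addnK.
  case=> m'; rewrite mem_filter mem_monomials => /andP[mA /eqP md] ->.
  rewrite mnm_supportD mnm_support_mesym1 mdegD mdeg_mesym1 md subnK //.
  by rewrite (setUidPr mA).
rewrite -size_filter; apply/eqP; rewrite size_eq0 -[_ == _]negbK -has_filter.
apply/hasPn => m; rewrite mem_monomials => /eqP md; apply: contraTneq dA => <-.
have /submK mE : (mesym1 (mnm_support m) <= m)%MM by rewrite mesym1_le.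
by rewrite -leqNgt -md -[leqRHS](congr1 mdeg mE) mdegD mdeg_mesym1 leq_addl.
Qed.

Lemma count_monomials_level (P : {set {set 'I_n}}) d :
  count (fun m => mnm_support m \in P) (monomials d) =
  (\sum_(j < n.+1) #|level P j| * shifted_count j j d)%N.
Proof.
rewrite -sum1_count (partition_big mnm_support (mem P)) //=.
transitivity (\sum_(A in P) shifted_count #|A| #|A| d)%N.
  apply: eq_bigr => A AP; rewrite -count_monomials_exact_support -sum1_count.
  by apply: eq_bigl => m; case: eqP => [->|]; rewrite ?andbF // AP.
have cA (A : {set 'I_n}) : (#|A| < n.+1)%N by rewrite ltnS -[n in (_ <= n)%N]card_ord max_card.
rewrite (partition_big (fun A => Ordinal (cA A)) predT) //=.
apply: eq_bigr => j _; rewrite -sum_nat_const; apply: eq_big => [A|A /andP[_ /eqP <-]] //.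
by rewrite inE.
Qed.

End Monomials.

(** * Hilbert functions of squarefree monomial ideals *)

Section Dimension.
Variables (K : fieldType) (n : nat) (V : lmodType {mpoly K[n]}) (W : V -> Prop).

Lemma has_dim_le d d' : has_dim W d -> has_dim W d' -> (d <= d')%N.
Proof.
move=> [b [Wb bP]] [b' [Wb' b'P]].
have /choice [M MP] : forall i, exists c : {ffun 'I_d' -> K}, b i = \sum_j (c j)%:MP_[n] *: b' j.
  by move=> i; have [c [cE _]] := b'P _ (Wb i); exists c.
have /choice [M' M'P] : forall j, exists c : {ffun 'I_d -> K}, b' j = \sum_i (c i)%:MP_[n] *: b i.
  by move=> j; have [c [cE _]] := bP _ (Wb' j); exists c.
apply: (@mulmx1_min _ _ _ (\matrix_(i, j) M i j) (\matrix_(j, i) M' j i)).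
apply/matrixP=> i k; rewrite !mxE.
have [c [_ cU]] := bP _ (Wb i).
have <- : c k = (i == k)%:R.
  rewrite (cU [ffun k => (i == k)%:R]) ?ffunE // (bigD1 i) //= ffunE eqxx scale1r.
  by rewrite big1 ?addr0 // => l li; rewrite ffunE eq_sym (negPf li) scale0r.
rewrite (cU [ffun k => \sum_j M i j * M' j k]).
  by rewrite ffunE; apply: eq_bigr => j _; rewrite !mxE.
rewrite {1}(MP i); under eq_bigr => j _ do rewrite (M'P j) scaler_sumr.
rewrite exchange_big; apply: eq_bigr => l _ /=.
rewrite ffunE rmorph_sum scaler_suml; apply: eq_bigr => j _ /=.
by rewrite scalerA mpolyCM.
Qed.

Lemma has_dim_unique d d' : has_dim W d -> has_dim W d' -> d = d'.
Proof. by move=> dW d'W; apply/eqP; rewrite eqn_leq !has_dim_le. Qed.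

Lemma has_dim_seq (T : eqType) (s : seq T) (b : T -> V) :
  uniq s -> (forall t, t \in s -> W (b t)) ->
  (forall v, W v -> exists c : T -> K, v = \sum_(t <- s) (c t)%:MP_[n] *: b t) ->
  (forall c : T -> K, \sum_(t <- s) (c t)%:MP_[n] *: b t = 0 ->
     forall t, t \in s -> c t = 0) ->
  has_dim W (size s).
Proof.
move=> us Wb bs bfree; case: s us Wb bs bfree => [|t0 s'].
  move=> _ _ bs _; exists (fun _ => 0); split=> [[]//|v /bs [c vE]].
  exists [ffun _ => 0]; split=> [|c' _]; first by rewrite vE big_nil big_ord0.
  by apply/ffunP=> -[].
set s := t0 :: s' => us Wb bs bfree.
have sumE (c : T -> K) : \sum_(t <- s) (c t)%:MP_[n] *: b t =
    \sum_(i < size s) (c (nth t0 s i))%:MP_[n] *: b (nth t0 s i).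
  by rewrite (big_nth t0) big_mkord.
exists (fun i => b (nth t0 s i)); split=> [i|v /bs [c vE]]; first exact/Wb/mem_nth.
exists [ffun i : 'I_(size s) => c (nth t0 s i)]; split.
  by rewrite vE sumE; apply: eq_bigr => i _; rewrite ffunE.
move=> c' vE'; apply/ffunP=> i; rewrite ffunE.
pose e t := c t - (if insub (index t s) is Some k then c' k else 0).
have eE (k : 'I_(size s)) : e (nth t0 s k) = c (nth t0 s k) - c' k.
  by rewrite /e index_uniq // valK.
have : \sum_(t <- s) (e t)%:MP_[n] *: b t = 0.
  rewrite sumE; under eq_bigr => k _ do rewrite eE mpolyCB scalerBl.
  by rewrite sumrB -sumE -vE -vE' subrr.
by move/bfree/(_ _ (mem_nth t0 (ltn_ord i))); rewrite eE => /eqP; rewrite subr_eq0 => /eqP.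
Qed.

End Dimension.

Section SquarefreeIdeal.
Variables (K : fieldType) (n : nat) (I : idealr {mpoly K[n]}).
Hypothesis I_sqf : squarefree_monomial_ideal I.
Local Notation S := {mpoly K[n]}.

Definition sqf_monomial (A : {set 'I_n}) : S := 'X_[mesym1 A].

Definition sqf_supports : {set {set 'I_n}} := [set A | sqf_monomial A \in I].

Lemma sqf_monomialE (A : {set 'I_n}) : \prod_(i in A) 'X_i = sqf_monomial A.
Proof.
rewrite mprodXE; congr 'X_[_]; apply/mnmP=> i; rewrite mnmE mnm_sumE.
rewrite big_mkcond (bigD1 i) //= mnm1E eqxx /= big1 ?addn0; first by case: (_ \in _).
by move=> j ji; case: (_ \in _); rewrite // mnm1E (negPf ji).
Qed.

Lemma sqf_supports_up (A B : {set 'I_n}) : A \in sqf_supports -> A \subset B -> B \in sqf_supports.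
Proof.
rewrite !inE => AI AB; rewrite /sqf_monomial -(@submK _ (mesym1 A) (mesym1 B)).
  by rewrite mpolyXD idealMr.
by rewrite mesym1_le mnm_support_mesym1.
Qed.

Lemma sqf_supports0 : set0 \notin sqf_supports.
Proof. by rewrite inE /sqf_monomial mesym1_set0 mpolyX0 idealr1. Qed.

(** A monomial of a member of I is divisible by one of the generators, so its
    radical lies in I. *)
Lemma ideal_msupp p m : p \in I -> m \in msupp p -> mnm_support m \in sqf_supports.
Proof.
have [G GP] := I_sqf => pI mp; have /GP [c pE] := pI.
set gs := map _ G in pE.
have [i iG mi] : exists2 i, (i < size gs)%N & (c i * gs`_i)@_m != 0.
  apply: NNPP => no; move: mp; rewrite mcoeff_msupp pE raddf_sum /= big1 ?eqxx //.
  by move=> i _; apply/eqP/negPn/negP => mi; apply: no; exists i.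
have iG' : (i < size G)%N by rewrite -(size_map (fun A : {set 'I_n} => \prod_(i in A) 'X_i : S)).
move: mi; rewrite (nth_map set0) // sqf_monomialE; set A := nth set0 G i.
have AI : A \in sqf_supports.
  rewrite inE; apply/GP; exists (fun k => (k == i)%:R).
  have ig : (i < size gs)%N by [].
  rewrite (bigD1 (Ordinal ig)) //= eqxx scale1r big1 ?addr0.
    by rewrite (nth_map set0) // sqf_monomialE.
  by move=> k ki; rewrite -val_eqE /= in ki; rewrite (negPf ki) scale0r.
rewrite -mcoeff_msupp => /msuppM_le /allpairsP [[m1 m2] /= [_]].
rewrite msuppX inE => /eqP -> ->; apply: sqf_supports_up AI _.
by rewrite mnm_supportD mnm_support_mesym1 subsetUr.
Qed.

Lemma mnm_support_ideal m : ('X_[m] \in I) = (mnm_support m \in sqf_supports).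
Proof.
apply/idP/idP => [mI|]; first by apply: (ideal_msupp mI); rewrite msuppX inE.
rewrite inE /sqf_monomial => mI; rewrite -(@submK _ (mesym1 (mnm_support m)) m).
  by rewrite mpolyXD idealMr.
by rewrite mesym1_le.
Qed.

Definition monomials_in (P : {set {set 'I_n}}) (i : int) : seq 'X_{1..n} :=
  if i is Posz d then [seq m <- monomials n d | mnm_support m \in P] else [::].

Lemma monomials_in_uniq P i : uniq (monomials_in P i).
Proof. by case: i => d //=; rewrite filter_uniq ?monomials_uniq. Qed.

Lemma size_monomials_in P (d : nat) : size (monomials_in P d) =
  (\sum_(j < n.+1) #|level P j| * shifted_count j j d)%N.
Proof. by rewrite size_filter count_monomials_level. Qed.

Lemma mem_monomials_in P i m : m \in monomials_in P i ->
  mnm_support m \in P /\ std_comp i ('X_[m] : S).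
Proof.
case: i => d //=; rewrite mem_filter mem_monomials => /andP[mP /eqP md].
by rewrite dhomogX; split=> //; apply/eqP.
Qed.

Lemma std_comp_sum i (p : S) : std_comp i p ->
  p = \sum_(m <- monomials_in setT i) p@_m *: 'X_[m].
Proof.
case: i => [d|d] /= pd; last by rewrite big_nil.
apply/mpolyP => m; rewrite raddf_sum /=.
have [md|md] := eqVneq (mdeg m) d; last first.
  rewrite (dhomog_nemf_coeff pd md) big_seq big1 // => m'.
  rewrite mem_filter mem_monomials => /andP[_ m'd].
  rewrite mcoeffZ mcoeffX; case: eqP => [mm|]; last by rewrite mulr0.
  by rewrite -mm m'd in md.
rewrite (bigD1_seq m) /=; first last.
- by rewrite filter_uniq ?monomials_uniq.
- by rewrite mem_filter mem_monomials md eqxx inE.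
rewrite mcoeffZ mcoeffX eqxx mulr1 big1 ?addr0 // => m' mm'.
by rewrite mcoeffZ mcoeffX (negPf mm') mulr0.
Qed.

Lemma sum_monomials_setU P i (F : 'X_{1..n} -> S) :
  \sum_(m <- monomials_in setT i) F m =
  \sum_(m <- monomials_in P i) F m + \sum_(m <- monomials_in (~: P) i) F m.
Proof.
case: i => d /=; last by rewrite !big_nil addr0.
rewrite !big_filter (bigID (fun m => mnm_support m \in P)) /=.
by congr (_ + _); apply: eq_bigl => m; rewrite !inE.
Qed.

Lemma mcoeff_sum_monomials (s : seq 'X_{1..n}) (c : 'X_{1..n} -> K) m :
  uniq s -> m \in s -> (\sum_(m' <- s) c m' *: 'X_[m'] : S)@_m = c m.
Proof.
move=> us ms; rewrite raddf_sum (bigD1_seq m) //= mcoeffZ mcoeffX eqxx mulr1.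
by rewrite big1 ?addr0 // => m' mm'; rewrite mcoeffZ mcoeffX (negPf mm') mulr0.
Qed.

Lemma ideal_hilbert_series :
  has_hilbert_series (ideal_graded (squarefree_monomial_homogeneous I_sqf))
    (fun i => size (monomials_in sqf_supports i)).
Proof.
move=> i; pose b m : ideal_mod I := insubd 0 'X_[m].
have bE m : mnm_support m \in sqf_supports -> val (b m) = 'X_[m].
  by move=> mU; rewrite /b val_insubd mnm_support_ideal mU.
have valsum (c : 'X_{1..n} -> K) :
    val (\sum_(m <- monomials_in sqf_supports i) (c m)%:MP_[n] *: b m : ideal_mod I) =
    \sum_(m <- monomials_in sqf_supports i) c m *: 'X_[m].
  rewrite raddf_sum; apply: eq_big_seq => m /mem_monomials_in [mU _] /=.
  by rewrite bE // mul_mpolyC.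
apply: (@has_dim_seq _ _ (ideal_mod I) _ _ (monomials_in sqf_supports i) b).
- exact: monomials_in_uniq.
- by move=> m /mem_monomials_in [mU mi]; rewrite /= /ideal_comp bE.
- move=> v vi; exists (fun m => (val v)@_m); apply: val_inj; rewrite valsum.
  rewrite {1}(std_comp_sum vi) (sum_monomials_setU sqf_supports).
  rewrite [X in _ + X]big_seq [X in _ + X]big1 ?addr0 // => m /mem_monomials_in [mU _].
  rewrite (_ : _@_m = 0) ?scale0r //; apply: contraTeq mU.
  rewrite -mcoeff_msupp inE negbK; apply: ideal_msupp; exact: valP.
- move=> c /(congr1 val); rewrite valsum => c0 m ms.
  by rewrite -(mcoeff_sum_monomials c (monomials_in_uniq _ _) ms) c0 mcoeff0.
Qed.

Lemma quot_hilbert_series :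
  has_hilbert_series (quot_graded (squarefree_monomial_homogeneous I_sqf))
    (fun i => size (monomials_in (~: sqf_supports) i)).
Proof.
move=> i; pose b m : {ideal_quot I} := \pi_{ideal_quot I}%qT 'X_[m].
have pisum (s : seq 'X_{1..n}) (c : 'X_{1..n} -> K) :
    \sum_(m <- s) (c m)%:MP_[n] *: b m = \pi_{ideal_quot I}%qT (\sum_(m <- s) c m *: 'X_[m]).
  rewrite raddf_sum; apply: eq_bigr => m _.
  by apply: esym; rewrite -mul_mpolyC; apply: rmorphM.
apply: (@has_dim_seq _ _ {ideal_quot I} _ _ (monomials_in (~: sqf_supports) i) b).
- exact: monomials_in_uniq.
- by move=> m /mem_monomials_in [_ mi]; exists 'X_[m].
- move=> _ [p pi ->]; exists (fun m => p@_m); rewrite pisum.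
  rewrite [in LHS](std_comp_sum pi) (sum_monomials_setU sqf_supports) raddfD /=.
  rewrite -[RHS]add0r; congr (_ + _); apply/eqP; rewrite quot_pi_eq0.
  rewrite big_seq rpred_sum // => m /mem_monomials_in [mU _].
  by rewrite -mul_mpolyC idealMr // mnm_support_ideal.
- move=> c; rewrite pisum => /eqP; rewrite quot_pi_eq0 => cI m ms.
  have [mU _] := mem_monomials_in ms; apply: contraTeq mU => cm.
  rewrite inE negbK; apply: (ideal_msupp cI).
  by rewrite mcoeff_msupp mcoeff_sum_monomials // monomials_in_uniq.
Qed.

End SquarefreeIdeal.

(** * Direct sums of shifted polynomial rings in fewer variables *)

Section Truncation.
Variables (K : fieldType) (n : nat).
Local Notation S := {mpoly K[n]}.

(** The projection of S onto K[x_0, ..., x_(j-1)], which lets S act on that ring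
    and identifies the ring with a subset of S. *)
Definition truncate j (p : S) : S :=
  p \mPo [tuple (if (i < j)%N then 'X_i else 0) | i < n].

HB.instance Definition _ j := GRing.RMorphism.copy (truncate j) (comp_mpoly _).
HB.instance Definition _ j := GRing.Linear.copy (truncate j) (comp_mpoly _).

Lemma truncateZ j c p : truncate j (c *: p) = c *: truncate j p.
Proof. exact: comp_mpolyZ. Qed.

Definition first_vars j : {set 'I_n} := [set i : 'I_n | (i < j)%N].

Lemma truncateX j m :
  truncate j 'X_[m] = if mnm_support m \subset first_vars j then 'X_[m] else 0.
Proof.
rewrite /truncate comp_mpolyX; case: ifP => [/subsetP sub|/negbT].
  rewrite [RHS]mpolyXE_id; apply: eq_bigr => i _; rewrite tnth_mktuple.
  have := sub i; rewrite !inE; have [->|_ /(_ isT) ->] := eqVneq (m i) 0%N; last by [].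
  by rewrite !expr0.
case/subsetPn => i; rewrite !inE => mi ij; rewrite (bigD1 i) //= tnth_mktuple.
by rewrite (negPf ij) expr0n (negPf mi) mul0r.
Qed.

Lemma truncateE j p : truncate j p =
  \sum_(m <- msupp p | mnm_support m \subset first_vars j) p@_m *: 'X_[m].
Proof.
rewrite {1}[p]mpolyE raddf_sum [RHS]big_mkcond; apply: eq_bigr => m _ /=.
by rewrite linearZ /= truncateX; case: ifP => // _; rewrite scaler0.
Qed.

Lemma truncateP j p : reflect
  (forall m, m \in msupp p -> mnm_support m \subset first_vars j) (truncate j p == p).
Proof.
apply: (iffP eqP) => [pE m mp|sub].
  apply: contraTT mp => nsub; rewrite -mcoeff_eq0 -pE truncateE raddf_sum big1 //= => m' sub'.
  rewrite mcoeffZ mcoeffX; case: eqP => [mm|]; last by rewrite mulr0.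
  by rewrite -mm sub' in nsub.
rewrite truncateE big_seq_cond [RHS]mpolyE [RHS]big_seq; apply: eq_bigl => m.
by case: (boolP (m \in _)) => //= /sub ->.
Qed.

Lemma truncate_pihomog j d p :
  truncate j (pihomog mdeg d p) = pihomog mdeg d (truncate j p).
Proof.
have lE (f : {linear S -> S}) : f p = \sum_(m <- msupp p) p@_m *: f 'X_[m].
  by rewrite {1}[p]mpolyE linear_sum; apply: eq_bigr => m _; rewrite linearZ.
rewrite (lE (pihomog mdeg d)) (lE (truncate j)).
rewrite (linear_sum (truncate j)) (linear_sum (pihomog mdeg d)); apply: eq_bigr => m _ /=.
rewrite !linearZ /= pihomogX truncateX; congr (_ *: _).
by case: ifP => md; case: ifP => sub; rewrite ?raddf0 ?truncateX ?sub ?pihomogX ?md.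
Qed.

Lemma truncate_homog j d p : p \is d.-homog -> truncate j p \is d.-homog.
Proof.
by rewrite !homog_piE => /eqP pd; rewrite -truncate_pihomog pd.
Qed.

Lemma truncate_std_pr j i p : truncate j p = p -> truncate j (std_pr i p) = std_pr i p.
Proof. by case: i => [d|d] pE /=; rewrite ?raddf0 // truncate_pihomog pE. Qed.

Lemma truncate_var j (i : 'I_n) : (i < j)%N -> truncate j 'X_i = 'X_i.
Proof.
move=> ij; apply/eqP/truncateP => m; rewrite msuppX inE => /eqP ->.
by apply/subsetP=> k; rewrite !inE mnm1E; have [<-|] := eqVneq i k.
Qed.

End Truncation.

Section ShiftedSum.
Variables (K : fieldType) (n P : nat) (nvars shift : 'I_P -> nat).
Local Notation S := {mpoly K[n]}.

Definition truncated : {pred {ffun 'I_P -> S}} :=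
  fun v => [forall p, truncate (nvars p) (v p) == v p].

Fact truncated_zmod_closed : zmod_closed truncated.
Proof.
split=> [|u v /forallP uT /forallP vT]; apply/forallP => p; rewrite !ffunE.
  by rewrite raddf0.
by rewrite (raddfB (truncate (nvars p))) /= (eqP (uT p)) (eqP (vT p)).
Qed.
HB.instance Definition _ := GRing.isZmodClosed.Build _ truncated truncated_zmod_closed.

(** The direct sum over p of the rings K[x_0, ..., x_(nvars p - 1)]; the shifts
    enter through the grading only. *)
Record shifted_sum := ShiftedSum { shifted_val :> {ffun 'I_P -> S}; _ : shifted_val \in truncated }.

HB.instance Definition _ := [isSub for shifted_val].
HB.instance Definition _ := [Choice of shifted_sum by <:].
HB.instance Definition _ := [SubChoice_isSubZmodule of shifted_sum by <:].

Lemma shifted_sumP (v : shifted_sum) p : truncate (nvars p) (val v p) = val v p.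
Proof. by have /forallP/(_ p)/eqP := valP v. Qed.

Fact shifted_scale_subproof (a : S) (v : shifted_sum) :
  [ffun p => truncate (nvars p) a * val v p] \in truncated.
Proof.
apply/forallP=> p; rewrite ffunE rmorphM /= shifted_sumP.
suff -> : truncate (nvars p) (truncate (nvars p) a) = truncate (nvars p) a by [].
apply/eqP/truncateP => m; rewrite mcoeff_msupp truncateE raddf_sum /=.
apply: contraR => nsub; rewrite big1 ?eqxx // => m' sub'.
rewrite mcoeffZ mcoeffX; case: eqP => [mm|]; last by rewrite mulr0.
by rewrite -mm sub' in nsub.
Qed.

Definition shifted_scale a v := ShiftedSum (shifted_scale_subproof a v).

Fact shifted_scaleA a b v : shifted_scale a (shifted_scale b v) = shifted_scale (a * b) v.
Proof. by apply/val_inj/ffunP => p; rewrite !ffunE rmorphM mulrA. Qed.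

Fact shifted_scale1 : left_id 1 shifted_scale.
Proof. by move=> v; apply/val_inj/ffunP => p; rewrite ffunE rmorph1 mul1r. Qed.

Fact shifted_scaleDr : right_distributive shifted_scale +%R.
Proof. by move=> a u v; apply/val_inj/ffunP => p; rewrite !ffunE mulrDr. Qed.

Fact shifted_scaleDl v : {morph shifted_scale^~ v : a b / a + b}.
Proof. by move=> a b; apply/val_inj/ffunP => p; rewrite !ffunE raddfD mulrDl. Qed.

HB.instance Definition _ := GRing.Zmodule_isLmodule.Build S shifted_sum
  shifted_scaleA shifted_scale1 shifted_scaleDr shifted_scaleDl.

Lemma shifted_valZ a (v : shifted_sum) p :
  val (a *: v) p = truncate (nvars p) a * val v p.
Proof. by rewrite ffunE. Qed.

Lemma shifted_val_sum T (r : seq T) (F : T -> shifted_sum) p :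
  val (\sum_(t <- r) F t) p = \sum_(t <- r) val (F t) p.
Proof. by rewrite raddf_sum sum_ffunE. Qed.

Definition shifted_comp (i : int) (v : shifted_sum) :=
  forall p, std_comp (i - (shift p)%:Z) (val v p).

Fact shifted_comp0 i : shifted_comp i 0.
Proof. by move=> p; rewrite ffunE; apply: std_comp0. Qed.

Fact shifted_compD i u v :
  shifted_comp i u -> shifted_comp i v -> shifted_comp i (u + v).
Proof. by move=> ui vi p; rewrite ffunE; apply: std_compD. Qed.

Fact shifted_compZ (d : nat) i a v :
  a \is d.-homog -> shifted_comp i v -> shifted_comp (d%:Z + i) (a *: v).
Proof.
by move=> ad vi p; rewrite shifted_valZ -addrA; apply: std_compM (truncate_homog _ ad) (vi p).
Qed.

Fact shifted_pr_subproof i (v : shifted_sum) :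
  [ffun p => std_pr (i - (shift p)%:Z) (val v p)] \in truncated.
Proof. by apply/forallP=> p; rewrite ffunE truncate_std_pr // shifted_sumP. Qed.

Fact shifted_comp_sum v : exists (s : seq int) (f : int -> shifted_sum),
  (forall i, shifted_comp i (f i)) /\ v = \sum_(i <- s) f i.
Proof.
pose M := \max_p (shift p + msize (val v p))%N.
exists [seq Posz d | d <- iota 0 M], (fun i => ShiftedSum (shifted_pr_subproof i v)).
split=> [i p|]; first by rewrite ffunE; apply: std_prP.
apply/val_inj/ffunP => p; rewrite shifted_val_sum big_map.
have pM : (shift p + msize (val v p) <= M)%N by apply: (leq_bigmax p).
have -> : M = (shift p + (M - shift p))%N by lia.
rewrite -[X in iota _ X]subn0 -/(index_iota 0 _) big_mkord.
rewrite big_split_ord /= big1 ?add0r => [|d _]; last first.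
  rewrite ffunE /=; have := ltn_ord d.
  by case dE: (d%:Z - (shift p)%:Z) => [e|e] //= ds; exfalso; lia.
rewrite {1}[v p](@pihomog_partitionE _ _ mdeg (M - shift p)%N); last first.
  by apply: leq_trans (leq_sub2r (shift p) pM); rewrite addKn.
apply: eq_bigr => d _; rewrite ffunE /=.
by rewrite (_ : (shift p + d)%:Z - (shift p)%:Z = d%:Z) //; lia.
Qed.

Fact shifted_comp_direct (s : seq int) (f : int -> shifted_sum) :
  uniq s -> (forall i, shifted_comp i (f i)) -> \sum_(i <- s) f i = 0 ->
  forall i, i \in s -> f i = 0.
Proof.
move=> us fi f0 i si; apply/val_inj/ffunP => p; rewrite [in RHS]ffunE.
pose g j := val (f (j + (shift p)%:Z)) p.
have gj j : std_comp j (g j).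
  by have := fi (j + (shift p)%:Z) p; rewrite addrK.
have -> : val (f i) p = g (i - (shift p)%:Z) by rewrite /g subrK.
rewrite -(@std_pr_sum _ _ _ [seq j - (shift p)%:Z | j <- s] g) //; first last.
- by apply: map_f.
- by rewrite map_inj_uniq //; apply: addIr.
rewrite big_map (eq_bigr (fun j => val (f j) p)) => [|j _]; last by rewrite /g subrK.
rewrite -shifted_val_sum f0 ffunE.
by case: (i - _) => //= d; rewrite raddf0.
Qed.

Definition shifted_graded : gradedModule K n :=
  @GradedModule K n shifted_sum shifted_comp shifted_comp0 shifted_compD
    shifted_compZ shifted_comp_sum shifted_comp_direct.

End ShiftedSum.

Lemma var_in_max_ideal (K : fieldType) n (j : 'I_n) : in_max_ideal ('X_j : {mpoly K[n]}).
Proof.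
exists (fun k : nat => (k == j :> nat)%:R).
rewrite -(big_mkord xpredT (fun k : nat => (k == j :> nat)%:R *: nth _ _ k)).
rewrite size_map size_enum_ord big_mkord (bigD1 j) //= eqxx scale1r.
rewrite (nth_map j) ?size_enum_ord ?ltn_ord // nth_ord_enum big1 ?addr0 // => k kj.
by rewrite val_eqE (negPf kj) scale0r.
Qed.

Section ShiftedSumTheory.
Variables (K : fieldType) (n P : nat) (nvars shift : 'I_P -> nat).
Local Notation S := {mpoly K[n]}.
Local Notation N := (@shifted_sum K n P nvars).

Fact shifted_unit_subproof (p : 'I_P) :
  [ffun q => (p == q)%:R : S] \in @truncated K n P nvars.
Proof.
apply/forallP=> q; rewrite ffunE; case: (p == q); last by rewrite (raddf0 (truncate (nvars q))).
by rewrite (rmorph1 (truncate (nvars q))).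
Qed.

Definition shifted_unit p : N := ShiftedSum (shifted_unit_subproof p).

Lemma shifted_val_unit p q : val (shifted_unit p) q = (p == q)%:R.
Proof. by rewrite ffunE. Qed.

Lemma shifted_fin_generated : fin_generated N.
Proof.
exists [seq shifted_unit p | p : 'I_P] => v.
exists (fun i => if insub i is Some p then val v p else 0).
rewrite -(big_mkord xpredT (fun i => (if insub i is Some p then val v p else 0)
  *: nth 0 [seq shifted_unit p | p : 'I_P] i)) size_map size_enum_ord big_mkord.
apply/val_inj/ffunP => q; rewrite shifted_val_sum (bigD1 q) //= valK.
rewrite (nth_map q) ?size_enum_ord ?ltn_ord // nth_ord_enum shifted_valZ.
rewrite shifted_val_unit eqxx mulr1 shifted_sumP big1 ?addr0 // => p pq.
rewrite valK (nth_map q) ?size_enum_ord ?ltn_ord // nth_ord_enum shifted_valZ.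
by rewrite shifted_val_unit (negPf pq) mulr0.
Qed.

Lemma shifted_hilbert_series : (forall p, (nvars p <= n)%N) ->
  has_hilbert_series (@shifted_graded K n P nvars shift) (fun i =>
    \sum_(p < P) if i is Posz d then shifted_count (nvars p) (shift p) d else 0%N)%N.
Proof.
move=> nvars_le i.
pose mons p : seq 'X_{1..n} :=
  monomials_in [set A : {set 'I_n} | A \subset first_vars n (nvars p)] (i - (shift p)%:Z).
pose s := [seq (p, m) | p <- enum 'I_P, m <- mons p].
have mons_size p : size (mons p) =
    (if i is Posz d then shifted_count (nvars p) (shift p) d else 0)%N.
  have cA : #|first_vars n (nvars p)| = nvars p.
    have inj : injective (widen_ord (nvars_le p)) by move=> x y /(congr1 val) xy; apply: val_inj.
    rewrite -[RHS]card_ord -(card_imset _ inj).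
    apply: eq_card => k; rewrite !inE; apply/idP/imsetP => [kp|[l _ ->]] /=.
      by exists (Ordinal kp) => //; apply: val_inj.
    exact: ltn_ord.
  rewrite /mons; clear s mons; case: i => d; last first.
    by rewrite (_ : _ - _ = Negz (d + shift p)) //; lia.
  rewrite /shifted_count; case: leqP => pd; last first.
    by case dE: (d%:Z - (shift p)%:Z) => [e|e] //; exfalso; lia.
  rewrite subzn // /= size_filter -{2}cA -count_monomials_support.
  by apply: eq_count => m; rewrite inE.
have us : uniq s.
  apply: allpairs_uniq_dep => [|p _|]; first exact: enum_uniq.
    exact: monomials_in_uniq.
  by move=> [p m] [p' m'] _ _ /= [-> ->].
have -> : (\sum_(p < P) if i is Posz d then shifted_count (nvars p) (shift p) d else 0)%N = size s.
  by rewrite size_allpairs_dep sumnE big_map big_enum; apply: eq_bigr.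
pose b (t : 'I_P * 'X_{1..n}) : N := 'X_[t.2] *: shifted_unit t.1.
have bE (c : 'I_P * 'X_{1..n} -> K) q :
    val (\sum_(t <- s) (c t)%:MP_[n] *: b t) q = \sum_(m <- mons q) c (q, m) *: 'X_[m].
  rewrite shifted_val_sum big_allpairs_dep /= (bigD1_seq q) ?mem_enum ?enum_uniq //=.
  rewrite [X in _ + X]big1 ?addr0 => [|p pq]; last first.
    by rewrite big1 // => m _; rewrite !ffunE (negPf pq) !mulr0.
  apply: eq_big_seq => m /(mem_monomials_in K) [mq _]; rewrite inE in mq.
  rewrite !ffunE eqxx mulr1 -(rmorphM (truncate (nvars q))) /= mul_mpolyC.
  by rewrite truncateZ truncateX mq.
apply: (@has_dim_seq _ _ N _ _ s b) => //.
- case=> p m /allpairsPdep [p' [m' [_ /(mem_monomials_in K) [mp mi] [-> ->]]]] q.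
  rewrite inE in mp.
  rewrite shifted_valZ shifted_val_unit; case: eqP => [<-|_]; last by rewrite mulr0; apply: std_comp0.
  by rewrite mulr1 truncateX mp.
- move=> v vi; exists (fun t => (val v t.1)@_t.2); apply/val_inj/ffunP => q.
  rewrite bE /= {1}[val v q](std_comp_sum (vi q)).
  rewrite (sum_monomials_setU [set A : {set 'I_n} | A \subset first_vars n (nvars q)]).
  rewrite [X in _ + X]big_seq [X in _ + X]big1 ?addr0 // => m /(mem_monomials_in K) [mU _].
  rewrite (_ : _@_m = 0) ?scale0r //; apply: contraTeq mU.
  rewrite -mcoeff_msupp !inE negbK; apply/truncateP/eqP; exact: shifted_sumP.
- move=> c c0 [p m] /allpairsPdep [p' [m' [_ mp [-> ->]]]].
  rewrite -(@mcoeff_sum_monomials K n (mons p') (fun m => c (p', m)) m') ?monomials_in_uniq //.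
  by rewrite -bE c0 ffunE mcoeff0.
Qed.

Variable r : nat.
Hypotheses (rn : (r <= n)%N) (r_nvars : forall p, (r <= nvars p)%N).

Definition leading_vars : seq S := [seq 'X_(widen_ord rn i) | i : 'I_r].

Lemma size_leading_vars : size leading_vars = r.
Proof. by rewrite /leading_vars size_map size_enum_ord. Qed.

Lemma nth_leading_vars (i : 'I_r) : leading_vars`_i = 'X_(widen_ord rn i).
Proof. by rewrite /leading_vars (nth_map i) ?size_enum_ord ?ltn_ord // nth_ord_enum. Qed.

Definition in_leading_ideal k (v : N) := forall p m, m \in msupp (val v p) ->
  exists2 i : 'I_n, (i < k)%N & m i != 0%N.

Lemma shifted_valX (i : 'I_r) (v : N) p :
  val (leading_vars`_i *: v) p = 'X_(widen_ord rn i) * val v p.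
Proof.
rewrite shifted_valZ nth_leading_vars truncate_var //.
exact: leq_trans (ltn_ord i) (r_nvars p).
Qed.

Lemma mcoeff_varM (i : 'I_n) (g : S) m :
  ('X_i * g)@_m = if m i == 0%N then 0 else g@_(m - U_(i)).
Proof.
case: ifP => [/eqP mi|/negbT mi].
  apply/eqP; rewrite mcoeff_eq0; apply/negP => /msuppM_le /allpairsP [[m1 m2] /= [+ _]].
  by rewrite msuppX inE => /eqP -> mE; move: mi; rewrite mE mnmDE mnm1E eqxx.
have {1}-> : m = (U_(i) + (m - U_(i)))%MM by rewrite addmC submK // lep1mP.
by rewrite mulrC mcoeffMX.
Qed.

(** The submodule generated by the first k variables is spanned by the monomials
    divisible by one of them.  In the inductive step the terms divisible by the
    new variable are split off from the others. *)
Lemma in_mulspan_leading k (v : N) : (k <= r)%N ->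
  in_mulspan (take k leading_vars) v <-> in_leading_ideal k v.
Proof.
elim: k v => [|k IH] v kr.
  rewrite take0; split=> [[w ->] p m|v0]; first by rewrite big_ord0 ffunE msupp0.
  exists (fun=> 0); rewrite big_ord0; apply/val_inj/ffunP => p; rewrite [in RHS]ffunE.
  apply/eqP; rewrite -msupp_eq0; case E: (msupp _) => [//|m ms].
  by have [|i] := v0 p m; first by rewrite E mem_head.
pose ik : 'I_r := Ordinal kr; pose jk : 'I_n := widen_ord rn ik.
rewrite in_mulspan_take ?size_leading_vars //; split.
  case=> [u [w [/(IH _ (ltnW kr)) uk ->]]] p m.
  rewrite ffunE (shifted_valX ik) => /msuppD_le; rewrite mem_cat => /orP[/uk [i ik' mi]|].
    by exists i => //; apply: ltnW.
  rewrite mcoeff_msupp mcoeff_varM; case: ifP => [_|/negbT mi _]; first by rewrite eqxx.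
  by exists jk.
move=> vk.
pose g p := val v p.
have gsupp p m : m \in msupp (g p) -> mnm_support m \subset first_vars n (nvars p).
  by move: m; apply/truncateP/eqP; exact: shifted_sumP.
have truncT p (Q : pred 'X_{1..n}) (f : 'X_{1..n} -> 'X_{1..n}) :
    (forall m, mnm_support (f m) \subset mnm_support m) ->
    truncate (nvars p) (\sum_(m <- msupp (g p) | Q m) (g p)@_m *: 'X_[f m]) =
    \sum_(m <- msupp (g p) | Q m) (g p)@_m *: 'X_[f m].
  move=> fm; rewrite (linear_sum (truncate (nvars p))) /= big_seq_cond [RHS]big_seq_cond.
  apply: eq_bigr => m /andP[/gsupp mp _].
  by rewrite truncateZ truncateX (subset_trans (fm m) mp).
have uT : [ffun p => \sum_(m <- msupp (g p) | m jk == 0%N) (g p)@_m *: 'X_[m]]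
    \in @truncated K n P nvars.
  by apply/forallP => p; rewrite ffunE (truncT p (fun m => m jk == 0%N) id).
have wT : [ffun p => \sum_(m <- msupp (g p) | m jk != 0%N) (g p)@_m *: 'X_[m - U_(jk)]]
    \in @truncated K n P nvars.
  apply/forallP => p; rewrite ffunE.
  rewrite (truncT p (fun m => m jk != 0%N) (fun m => m - U_(jk))%MM) // => m.
  apply/subsetP => l; rewrite !inE mnmBE; apply: contraNneq => ->.
  by rewrite sub0n.
exists (ShiftedSum uT), (ShiftedSum wT); split.
  apply/(IH _ (ltnW kr)) => p m; rewrite ffunE => mu.
  have [mv mj] : m \in msupp (g p) /\ m jk == 0%N.
    move: mu; rewrite mcoeff_msupp raddf_sum /= => /negP mu; apply: NNPP => nm.
    apply: mu; apply/eqP; rewrite big_seq_cond big1 // => m' /andP[m's m'j].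
    rewrite mcoeffZ mcoeffX; case: eqP => [mm|]; last by rewrite mulr0.
    by case: nm; rewrite -mm.
  have [i ik' mi] := vk p m mv; exists i => //.
  rewrite ltn_neqAle -ltnS ik' andbT; apply: contraNneq mi => iE.
  by rewrite (_ : i = jk) //; apply: val_inj.
apply/val_inj/ffunP => p; rewrite ffunE (shifted_valX ik) !ffunE -/(g p).
rewrite {1}[g p]mpolyE (bigID (fun m : 'X_{1..n} => m jk == 0%N)) /=; congr (_ + _).
rewrite mulr_sumr; apply: eq_bigr => m mj.
by rewrite -scalerAr -mpolyXD addmC submK // lep1mP.
Qed.

Lemma leading_vars_regular : (0 < P)%N -> regular_seq N leading_vars.
Proof.
move=> P0; split.
- by move=> _ /mapP[i _ ->]; apply: var_in_max_ideal.
- move=> i v; rewrite size_leading_vars => ir.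
  rewrite !in_mulspan_leading 1?ltnW // => xv p m mv.
  pose jk : 'I_n := widen_ord rn (Ordinal ir).
  have [|l li ml] := xv p (m + U_(jk))%MM.
    rewrite (shifted_valX (Ordinal ir)) mcoeff_msupp mcoeff_varM mnmDE mnm1E eqxx addn1 /=.
    by rewrite addmK -mcoeff_msupp.
  exists l => //; move: ml; rewrite mnmDE mnm1E; have [jl|_] := eqVneq jk l; last by rewrite addn0.
  by rewrite -jl ltnn in li.
- exists (shifted_unit (Ordinal P0)); rewrite -[leading_vars]take_size size_leading_vars.
  rewrite in_mulspan_leading // => /(_ (Ordinal P0) 0%MM).
  rewrite shifted_val_unit eqxx msupp1 mem_head => /(_ isT)[i _].
  by rewrite mnm0E.
Qed.

End ShiftedSumTheory.

(** * Hilbert depth *)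

Lemma exists_maximum (P : nat -> Prop) r0 B : P r0 -> (forall k, P k -> (k <= B)%N) ->
  exists2 r, (r0 <= r)%N & P r /\ forall k, P k -> (k <= r)%N.
Proof.
move=> P0 PB; have [m] := ubnP (B - r0)%N; elim: m r0 P0 => // m IH r0 P0 mB.
have [[k [Pk k0]]|nk] := classic (exists k, P k /\ (r0 < k)%N).
  have [|r kr Pr] := IH k Pk; first by have := PB _ Pk; have := PB _ P0; lia.
  by exists r => //; apply: leq_trans kr; apply: ltnW.
exists r0 => //; split=> // k Pk; rewrite leqNgt; apply/negP => k0.
by apply: nk; exists k.
Qed.

(** Since [h 0 = 0], all the iterated differences take the value [h 1] at 1, so
    r of them can be subtracted from [h 2]. *)
Lemma nonneg_differences_bound r h :
  nonneg_differences r h -> h 0%N = 0%N -> (r * h 1 <= h 2)%N.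
Proof.
elim: r h => // r IH h [hle /IH hr] h0.
by have := hle 1%N; move: hr; rewrite /= subnn h0 subn0 => /(_ erefl); lia.
Qed.

Section SameHilbertSeries.
Variables (K : fieldType) (n : nat) (M : gradedModule K n) (h : int -> nat).
Hypothesis hM : has_hilbert_series M h.

Lemma same_hilbert_seriesP N : same_hilbert_series M N -> has_hilbert_series N h.
Proof.
case=> h' [h'M h'N] i; rewrite (has_dim_unique (hM i) (h'M i)); exact: h'N.
Qed.

Variable e : int.
Hypotheses (he : h e = 0%N) (he1 : (0 < h (e + 1))%N).

Lemma regular_seq_bound (N : gradedModule K n) fs :
  has_hilbert_series N h -> regular_seq N fs -> (size fs <= h (e + 2))%N.
Proof.
move=> hN fsreg; have := regular_seq_nonneg_differences hN fsreg he.
move/nonneg_differences_bound; rewrite addr0 => /(_ he) /(leq_trans _); apply.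
by rewrite leq_pmulr.
Qed.

(** Both maxima in the definition of the Hilbert depth, over regular sequences
    and over modules, are attained because of the uniform bound. *)
Lemma has_hdepth_ge (N : gradedModule K n) fs : fin_generated N ->
  has_hilbert_series N h -> regular_seq N fs ->
  exists2 r, (size fs <= r)%N & has_hdepth M r.
Proof.
move=> fgN hN fsreg.
have [||d fsd [[gs gsreg gsd] dmax]] := @exists_maximum
  (fun k => exists2 gs, regular_seq N gs & size gs = k) (size fs) (h (e + 2)).
- by exists fs.
- by move=> _ [gs gsreg <-]; apply: regular_seq_bound gsreg.
have depthN : has_depth N d.
  by split; [exists gs | move=> gs' gs'reg; apply: dmax; exists gs'].
have [||r dr [Pr rmax]] := @exists_maximum (fun k => exists N : gradedModule K n,
    [/\ fin_generated N, same_hilbert_series M N & has_depth N k]) d (h (e + 2)).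
- by exists N; split=> //; exists h.
- by move=> k [N' [_ /same_hilbert_seriesP hN' [[gs' gs'reg <-] _]]]; apply: regular_seq_bound gs'reg.
exists r; first exact: leq_trans dr.
by split=> // N' k fgN' sN' dN'; apply: rmax; exists N'.
Qed.

End SameHilbertSeries.

(** * Comparing a squarefree monomial ideal with its quotient *)

Lemma sum_ord_tail (F : nat -> nat) a b :
  (forall j, (a <= j)%N -> F j = 0%N) -> (forall j, (b <= j)%N -> F j = 0%N) ->
  (\sum_(j < a) F j = \sum_(j < b) F j)%N.
Proof.
wlog ab : a b / (a <= b)%N.
  by move=> W Fa Fb; case: (leqP a b) => [|/ltnW] ab; [|symmetry]; apply: W.
move=> Fa _; rewrite -!(big_mkord xpredT F) (@big_cat_nat _ _ _ a 0%N b) //=.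
rewrite [X in (_ = _ + X)%N]big_nat [X in (_ = _ + X)%N]big1 ?addn0 // => j /andP[aj _].
exact: Fa.
Qed.

(** 1/(1 - t)^(j+1) = 1/(1 - t)^j + t/(1 - t)^(j+1). *)
Lemma shifted_countS j k d :
  shifted_count j.+1 k d = (shifted_count j k d + shifted_count j.+1 k.+1 d)%N.
Proof.
rewrite /shifted_count; case: (ltngtP k d) => [kd|//|->].
  by rewrite -(subnSK kd) count_monomialsS.
by rewrite subnn /= bin0 addn0; case: j => //= j; rewrite bin0.
Qed.

Section FVector.
Variables (n : nat) (U : {set {set 'I_n}}).

Lemma card_level_setC j : (#|level U j| + #|level (~: U) j|)%N = 'C(n, j).
Proof.
have := card_draws 'I_n j; rewrite card_ord => <-; rewrite -[RHS](cardsID U).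
by congr (_ + _)%N; apply: eq_card => A; rewrite !inE andbC.
Qed.

Lemma card_level_big j : (n < j)%N -> #|level U j| = 0%N.
Proof. by move=> nj; have := card_level_setC j; rewrite bin_small //; lia. Qed.

Lemma size_monomials_in_low (d : nat) : size (monomials_in U d) =
  (\sum_(j < d.+1) #|level U j| * shifted_count j j d)%N.
Proof.
rewrite size_monomials_in.
apply: (@sum_ord_tail (fun j => #|level U j| * shifted_count j j d)%N) => j jd.
  by rewrite card_level_big.
by rewrite /shifted_count leqNgt jd muln0.
Qed.

End FVector.

(** H is the Hilbert function of S/I shifted by one degree, c_k being the number
    of squarefree monomials of degree k outside I; the values of H come from the
    expansion of t^k/(1 - t)^k. *)
Lemma nonneg_differences4_low H c1 c2 c3 : nonneg_differences 4 H ->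
  H 0%N = 0%N -> H 1%N = 1%N -> H 2%N = c1 -> H 3%N = (c1 + c2)%N ->
  H 4%N = (c1 + 2 * c2 + c3)%N ->
  [/\ 4 <= c1, 3 * c1 <= c2 + 6 & 2 * c2 + 4 <= c3 + 3 * c1]%N.
Proof.
move=> /= [_ [_ [_ [H3 _]]]] h0 h1 h2 h3 h4.
have := H3 1%N; have := H3 2%N; have := H3 3%N.
rewrite /= h0 h1 h2 h3 h4 addKn => d3 d2 d1.
have {d1} c1_ge : (4 <= c1)%N by lia.
have {d2} c2_ge : (3 * c1 <= c2 + 6)%N by lia.
by split=> //; lia.
Qed.

Section Comparison.
Variables (n : nat) (U : {set {set 'I_n}}).
Local Notation a j := #|level U j%N|.
Local Notation hU := (fun i => size (monomials_in U i)).
Local Notation hC := (fun i => size (monomials_in (~: U) i)).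

(** The summands K[x_1, ..., x_j](-k), coded by (j, k), of the module with the
    Hilbert series of I.  The first four multiplicities are the coefficients of
    (1 - t)^4 times the sum of a_j t^j/(1 - t)^j over j <= 4. *)
Definition cutoff_shape : seq (nat * nat) :=
  nseq (a 1) (4, 1)%N ++ nseq (a 2 - 3 * a 1) (4, 2)%N ++
  nseq (a 3 + 3 * a 1 - 2 * a 2) (4, 3)%N ++
  nseq (a 4 + a 2 - (a 3 + a 1)) (4, 4)%N ++
  flatten [seq nseq (a j) (j, j) | j <- iota 5 (n - 4)].

Lemma cutoff_shape_bounds : (4 <= n)%N ->
  all (fun x => 4 <= x.1 <= n)%N cutoff_shape.
Proof.
move=> n4; apply/allP => x; rewrite !mem_cat !mem_nseq.
case/or4P=> [/andP[_ /eqP ->]|/andP[_ /eqP ->]|/andP[_ /eqP ->]|] //=.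
case/orP=> [/andP[_ /eqP ->] //|/flattenP[_ /mapP[j + ->]]].
by rewrite mem_iota mem_nseq => jn /andP[_ /eqP ->] /=; lia.
Qed.

Lemma sum_nseq (b : nat) (x : nat * nat) (F : nat * nat -> nat) :
  (\sum_(y <- nseq b x) F y = b * F x)%N.
Proof. by rewrite big_nseq iter_addn_0 mulnC. Qed.

Hypothesis U_up : forall A B : {set 'I_n}, A \in U -> A \subset B -> B \in U.
Hypothesis U0 : set0 \notin U.

Lemma level0 : a 0 = 0%N.
Proof.
apply/eqP; rewrite cards_eq0 -subset0; apply/subsetP => A; rewrite !inE cards_eq0.
by case/andP=> AU /eqP A0; rewrite A0 (negPf U0) in AU.
Qed.

Hypothesis diffC : nonneg_differences 4 (fun k => hC (-1 + k%:Z)).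

Lemma level_inequalities_of_differences :
  [/\ (4 <= n)%N, 3 * a 1 <= a 2, 2 * a 2 <= a 3 + 3 * a 1
    & a 3 + a 1 <= a 4 + a 2]%N.
Proof.
have cC j := card_level_setC U j.
have h0 : hC (-1 + 0%:Z) = 0%N by [].
have h1 : hC (-1 + 1%:Z) = 1%N.
  rewrite (size_monomials_in_low (~: U) 0) big_ord1 /=.
  by have := cC 0%N; rewrite level0 bin0 add0n => ->.
have h2 : hC (-1 + 2%:Z) = #|level (~: U) 1|.
  rewrite (size_monomials_in_low (~: U) 1) !big_ord_recr big_ord0 /=.
  by rewrite (_ : shifted_count 0 0 1 = 0)%N // (_ : shifted_count 1 1 1 = 1)%N // muln0 muln1.
have h3 : hC (-1 + 3%:Z) = (#|level (~: U) 1| + #|level (~: U) 2|)%N.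
  rewrite (size_monomials_in_low (~: U) 2) !big_ord_recr big_ord0 /=.
  rewrite (_ : shifted_count 0 0 2 = 0)%N // (_ : shifted_count 1 1 2 = 1)%N //.
  by rewrite (_ : shifted_count 2 2 2 = 1)%N // muln0 !muln1.
have h4 : hC (-1 + 4%:Z) = (#|level (~: U) 1| + 2 * #|level (~: U) 2| + #|level (~: U) 3|)%N.
  rewrite (size_monomials_in_low (~: U) 3) !big_ord_recr big_ord0 /=.
  rewrite (_ : shifted_count 0 0 3 = 0)%N // (_ : shifted_count 1 1 3 = 1)%N //.
  by rewrite (_ : shifted_count 2 2 3 = 2)%N // (_ : shifted_count 3 3 3 = 1)%N // muln0 !muln1 (mulnC 2%N).
have [c1 c2 c3] := nonneg_differences4_low diffC h0 h1 h2 h3 h4.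
have growth k : ((n - k) * a k <= k.+1 * a k.+1)%N.
  by have := level_growth U_up k; rewrite card_ord.
have few k t : (t <= a k)%N -> (2 * (t * (n - k)) <= 2 * a k.+1 + t * t.-1)%N.
  by move=> tk; have := level_growth_few U_up tk; rewrite card_ord.
have cE j : ('C(n, j) - a j)%N = #|level (~: U) j| by rewrite -cC addKn.
have aC j : (a j <= 'C(n, j))%N by rewrite -cC leq_addr.
have [] := level_inequalities growth few; rewrite ?cE -?cC ?leq_add2l ?leq_addr //.
by move=> i1 i2 i3; split=> //; rewrite -[n]bin1 -cC (leq_trans c1) ?leq_addl.
Qed.

Lemma sum_cutoff_shape d :
  (\sum_(x <- cutoff_shape) shifted_count x.1 x.2 d = hU d%:Z)%N.
Proof.
have [n4 i1 i2 i3] := level_inequalities_of_differences.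
rewrite size_monomials_in /cutoff_shape !big_cat big_flatten /= !sum_nseq /= big_map.
rewrite -(big_mkord xpredT (fun j => a j * shifted_count j j d)%N) /index_iota subn0.
have -> : n.+1 = (5 + (n - 4))%N by lia.
rewrite iotaD big_cat /= !big_cons big_nil level0 add0n.
under eq_bigr => j _ do rewrite sum_nseq.
rewrite (shifted_countS 3%N 1%N) (shifted_countS 3%N 2%N) (shifted_countS 3%N 3%N).
rewrite (shifted_countS 2%N 1%N) (shifted_countS 2%N 2%N) (shifted_countS 1%N 1%N).
(* Introducing the multiplicities as variables turns the claim into a polynomial
   identity without truncated subtractions. *)
have [b2 e2] : exists b, a 2 = (b + 3 * a 1)%N by exists (a 2 - 3 * a 1)%N; rewrite subnK.
have [b3 e3] : exists b, a 3 = (b + 2 * b2 + 3 * a 1)%N.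
  by exists (a 3 + 3 * a 1 - 2 * a 2)%N; lia.
have [b4 e4] : exists b, a 4 = (b + b3 + b2 + a 1)%N.
  by exists (a 4 + a 2 - (a 3 + a 1))%N; lia.
have -> : (a 2 - 3 * a 1 = b2)%N by lia.
have -> : (a 3 + 3 * a 1 - 2 * a 2 = b3)%N by lia.
have -> : (a 4 + a 2 - (a 3 + a 1) = b4)%N by lia.
rewrite {}e2 {}e3 {}e4 !addnA; congr (_ + _)%N.
move: (a 1) (shifted_count 1 1 d) (shifted_count 2 2 d) (shifted_count 3 3 d)
  (shifted_count 4 4 d) => a1 x1 x2 x3 x4.
by nia.
Qed.

End Comparison.

Theorem theorem3p14 (K : fieldType) (n : nat) (I : idealr {mpoly K[n]})
    (I_neq0 : exists2 p : {mpoly K[n]}, p \in I & p != 0)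
    (I_sqf : squarefree_monomial_ideal I) :
  has_hdepth (quot_graded (squarefree_monomial_homogeneous I_sqf)) 4 ->
  exists2 r : nat,
    has_hdepth (ideal_graded (squarefree_monomial_homogeneous I_sqf)) r &
    (4 <= r)%N.
Proof.
case=> [[N [_ sN [[fs fsreg fs4] _]]] _].
pose U := sqf_supports I.
have hN := same_hilbert_seriesP (quot_hilbert_series I_sqf) sN.
have diffC : nonneg_differences 4 (fun k => size (monomials_in (~: U) (-1 + k%:Z))).
  by rewrite -fs4; apply: regular_seq_nonneg_differences hN fsreg _.
have U_up := @sqf_supports_up K n I.
have U0 := sqf_supports0 I.
have [n4 _ _ _] := level_inequalities_of_differences U_up U0 diffC.
pose L := cutoff_shape U.
pose nvars (p : 'I_(size L)) := (nth (0, 0)%N L p).1.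
pose shift (p : 'I_(size L)) := (nth (0, 0)%N L p).2.
have nvarsP p : (4 <= nvars p <= n)%N.
  exact: (allP (cutoff_shape_bounds U n4) _ (mem_nth (0, 0)%N (ltn_ord p))).
have hI := ideal_hilbert_series I_sqf.
have hL : has_hilbert_series (@shifted_graded K n (size L) nvars shift)
    (fun i => size (monomials_in U i)).
  move=> i; have nvars_le p : (nvars p <= n)%N by case/andP: (nvarsP p).
  have := @shifted_hilbert_series K n (size L) nvars shift nvars_le i.
  case: i => d; last by rewrite big1.
  by rewrite -(sum_cutoff_shape U_up U0 diffC) (big_nth (0, 0)%N) big_mkord.
(* The grading of I starts in degree d; depths are bounded from there. *)
have [d d_gt0 dmin] : exists2 d : nat, (0 < size (monomials_in U d%:Z))%N &
    forall d' : nat, (0 < size (monomials_in U d'%:Z))%N -> (d <= d')%N.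
  have exd : exists d : nat, (0 < size (monomials_in U d%:Z))%N.
    have [p pI p0] := I_neq0.
    have [m mp] : exists m, m \in msupp p.
      by move: p0; rewrite -msupp_eq0; case: (msupp p) => // m s _; exists m; apply: mem_head.
    exists (mdeg m); rewrite -has_predT; apply/hasP; exists m => //.
    by rewrite mem_filter mem_monomials eqxx andbT; apply: ideal_msupp mp.
  by case: (ex_minnP exd) => d d0 dmin; exists d.
have he : size (monomials_in U (d%:Z - 1)) = 0%N.
  case: d dmin {d_gt0} => [//|d] dmin; rewrite -addn1 PoszD addrK.
  by apply/eqP; rewrite -leqn0 leqNgt; apply/negP => /dmin; rewrite ltnn.
have he1 : (0 < size (monomials_in U (d%:Z - 1 + 1)))%N by rewrite subrK.
have L0 : (0 < size L)%N.
  rewrite lt0n; apply: contraTneq d_gt0 => /size0nil LE.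
  by rewrite -(sum_cutoff_shape U_up U0 diffC) -/L LE big_nil.
have nvars4 p : (4 <= nvars p)%N by case/andP: (nvarsP p).
have [r r4 hr] := @has_hdepth_ge K n _ _ hI _ he he1 (shifted_graded K n nvars shift) _
  (shifted_fin_generated K n nvars) hL (leading_vars_regular K n4 nvars4 L0).
by exists r => //; rewrite size_leading_vars in r4.
Qed.
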